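(* Let $\mathbf n_\kappa=(n_\kappa(i))_{i\ge 0}$, $\kappa\ge 1$, be degree statistics such that, as $\kappa\to\infty$, $|\mathbf n_\kappa|\to\infty$ and $n_\kappa(i)/|\mathbf n_\kappa|\to p_i$ for every $i\ge 0$, where $\mathbf p=(p_i)_{i\ge0}$ is a probability distribution on $\mathbb N_0$. Let $\mathcal T_{\mathbf n_\kappa}\sim\mathrm{Unif}(\mathbb T_{\mathbf n_\kappa})$. Suppose that $f:\mathbb T\to\mathbb R$ is a functional of rooted trees such that the following conditions are satisfied: (i) there exists a real constant $0\le\gamma<\infty$ such that $\lim_{K\to\infty}\gamma_{\mathbf p}(f^{(K)})=\gamma$; (ii) $\displaystyle\lim_{K\to\infty}\limsup_{\kappa\to\infty}\frac{\mathrm{Var}(\widehat F^{(K)}(\mathcal T_{\mathbf n_\kappa}))}{|\mathbf n_\kappa|}=0$. Then, for the corresponding additive functional $F(T):=\sum_{v\in T}f(T_v)$, $$\frac{F(\mathcal T_{\mathbf n_\kappa})-\mathbb E[F(\mathcal T_{\mathbf n_\kappa})]}{\sqrt{|\mathbf n_\kappa|}}\to\mathrm N(0,\gamma)\quad\text{in distribution, as }\kappa\to\infty.$$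
   Context: $\mathbb N_0=\{0,1,2,\dots\}$. $\mathbb T$ is the set of all finite plane (i.e. ordered) rooted trees, up to isomorphism. For $T\in\mathbb T$, $|T|$ is its number of vertices and $n_T(i)$ is the number of vertices of $T$ with exactly $i$ children. A degree statistic is a sequence $\mathbf n=(n(i))_{i\ge0}$ of non-negative integers with $\sum_{i\ge0}n(i)=1+\sum_{i\ge0}i\,n(i)<\infty$; $|\mathbf n|:=\sum_{i\ge0}n(i)$; $\mathbb T_{\mathbf n}$ is the set of $T\in\mathbb T$ with $n_T(i)=n(i)$ for all $i$; $\mathrm{Unif}(\mathbb T_{\mathbf n})$ is the uniform distribution on it. For a vertex $v$ of $T$, the fringe subtree $T_v\in\mathbb T$ consists of $v$ and all its descendants, rooted at $v$. For $K>0$ set $f^{(K)}(T):=f(T)\mathbf 1_{\{|T|\le K\}}$, $\widehat f^{(K)}(T):=f(T)-f^{(K)}(T)$, and $\widehat F^{(K)}(T):=\sum_{v\in T}\widehat f^{(K)}(T_v)$. $\pi_{\mathbf p}(T):=\prod_{i\ge0}p_i^{n_T(i)}$ (with $0^0:=1$), and $\mathbb E_{\pi_{\mathbf p}}[g(\mathcal T)]:=\sum_{T\in\mathbb T}g(T)\pi_{\mathbf p}(T)$. For $g:\mathbb T\to\mathbb R$ with finite support (nonzero for only finitely many trees), with additive functional $G(T):=\sum_{v\in T}g(T_v)$, $$\gamma_{\mathbf p}(g):=2\mathbb E_{\pi_{\mathbf p}}[g(\mathcal T)G(\mathcal T)]-\mathbb E_{\pi_{\mathbf p}}[g(\mathcal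 T)^2]+\bigl(\mathbb E_{\pi_{\mathbf p}}[g(\mathcal T)(|\mathcal T|-1)]\bigr)^2-\sum_{i\ge0}\frac1{p_i}\bigl(\mathbb E_{\pi_{\mathbf p}}[g(\mathcal T)n_{\mathcal T}(i)]\bigr)^2\mathbf 1_{\{p_i>0\}},$$ where terms with $p_i=0$ in the sum are $0$. $\mathrm N(0,\gamma)$ is the normal distribution with mean $0$ and variance $\gamma$ (the point mass at $0$ if $\gamma=0$). *)

(* Defs.v *)
From HB Require Import structures.
From mathcomp Require Import all_boot all_order all_algebra.
From mathcomp Require Import finmap.
From mathcomp Require Import all_classical all_reals all_analysis.

Set Implicit Arguments.
Unset Strict Implicit.
Unset Printing Implicit Defensive.

Import Order.TTheory GRing.Theory Num.Theory.
Import numFieldNormedType.Exports.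

Local Open Scope classical_set_scope.
Local Open Scope ring_scope.

(* A finite plane rooted tree is the ordered list of the subtrees rooted at the
   children of its root, so isomorphic plane trees are equal. *)
Inductive tree : Type := Node of seq tree.

Fixpoint tree_encode (t : tree) : GenTree.tree void :=
  let: Node s := t in GenTree.Node 0 (map tree_encode s).

Fixpoint tree_decode (t : GenTree.tree void) : tree :=
  match t with
  | GenTree.Leaf _ => Node [::]
  | GenTree.Node _ s => Node (map tree_decode s)
  end.

Lemma tree_encodeK : cancel tree_encode tree_decode.
Proof.
rewrite /cancel; fix IH 1; case=> s /=; congr Node.
by elim: s => //= t s ->; rewrite IH.
Qed.

HB.instance Definition _ := Countable.copy tree (can_type tree_encodeK).

HB.instance Definition _ := isPointed.Build tree (Node [::]).

HB.instance Definition _ := @isMeasurable.Build default_measure_display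
  tree discrete_measurable discrete_measurable0
  discrete_measurableC discrete_measurableU.

(* The fringe subtrees T_v, one entry per vertex v of T (in preorder). *)
Fixpoint fringe (t : tree) : seq tree :=
  let: Node s := t in t :: flatten (map fringe s).

Definition root_degree (t : tree) : nat := let: Node s := t in size s.

Definition tree_size (t : tree) : nat := size (fringe t).

(* A vertex v has as many children in T as it has in T_v, where it is the
   root. *)
Definition n_children (t : tree) (i : nat) : nat :=
  count (fun u => root_degree u == i) (fringe t).

Definition stat_size (n : nat -> nat) : nat :=
  \big[addn/0%N]_(i \in [set: nat]) n i.

(* The n i are natural numbers, so finiteness of the sums amounts to finite
   support; this also makes the two finitely supported sums meaningful. *)
Definition degree_statistic (n : nat -> nat) : Prop :=
  finite_set [set i | n i != 0%N] /\
  stat_size n = (1 + \big[addn/0%N]_(i \in [set: nat]) (i * n i))%N.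

Definition trees_of (n : nat -> nat) : set tree :=
  [set t | forall i, n_children t i = n i].

(* X ~ Unif(A).  A is then finite and nonempty: otherwise fset_set A is empty,
   all the point masses are 0 and cannot sum to 1. *)
Definition uniform_on d (T : measurableType d) (R : realType)
    (P : probability T R) (X : {RV P >-> tree}) (A : set tree) : Prop :=
  forall t : tree,
    distribution P X [set t] = (\1_A t / (#|` fset_set A|)%:R)%:E.

Section functionals.
Variable R : realType.
Implicit Types (f g : tree -> R) (p : nat -> R) (K : nat).

Definition additive_functional f (t : tree) : R := \sum_(u <- fringe t) f u.

Definition truncate K f (t : tree) : R :=
  if (tree_size t <= K)%N then f t else 0.

Definition truncate_compl K f (t : tree) : R := f t - truncate K f t.

Definition prob_distribution p : Prop :=
  (forall i, 0 <= p i) /\ (\sum_(0 <= i <oo) (p i)%:E = 1)%E.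

Definition pi_weight p (t : tree) : R :=
  \big[*%R/1]_(i \in [set: nat]) p i ^+ n_children t i.

(* E_{pi_p}[g(T)] for finitely supported g; the finitely supported sum is 0 by
   convention when g * pi_p has infinite support. *)
Definition pi_expectation p g : R :=
  \sum_(t \in [set: tree]) g t * pi_weight p t.

(* gamma_p(g), for finitely supported g; then only finitely many terms of the
   sum over i are nonzero. *)
Definition gamma_variance p g : R :=
  2 * pi_expectation p (fun t => g t * additive_functional g t)
  - pi_expectation p (fun t => g t ^+ 2)
  + pi_expectation p (fun t => g t * ((tree_size t)%:R - 1)) ^+ 2
  - \sum_(i \in [set: nat])
      (if 0 < p i then
         (p i)^-1 * pi_expectation p (fun t => g t * (n_children t i)%:R) ^+ 2
       else 0).

(* N(0, v).  The degenerate case is separate because normal_prob 0 0 is not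
   the point mass at 0. *)
Definition centered_normal (v : R) :
    probability (measurableTypeR R) R :=
  if v == 0 then [the probability _ R of dirac (0 : measurableTypeR R)]
  else [the probability _ R of normal_prob 0 (Num.sqrt v)].

(* Convergence in distribution: weak convergence of the laws, the Y k being
   defined on possibly different probability spaces. *)
Definition cvg_in_distribution (d : nat -> measure_display)
    (T : forall k, measurableType (d k)) (P : forall k, probability (T k) R)
    (Y : forall k, T k -> R) (nu : probability (measurableTypeR R) R) : Prop :=
  forall phi : R -> R, continuous phi ->
    (exists M : R, forall x, `|phi x| <= M) ->
    ('E_(P k)[phi \o Y k])%E @[k --> \oo] --> (\int[nu]_x (phi x)%:E)%E.

End functionals.

(* Main.v *)
Require Import Defs.
From HB Require Import structures.
From mathcomp Require Import all_boot all_order all_algebra all_fingroup.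
From mathcomp Require Import finmap.
From mathcomp Require Import ring lra zify.
From mathcomp Require Import all_classical all_reals all_analysis measurable_realfun.

Set Implicit Arguments.
Unset Strict Implicit.
Unset Printing Implicit Defensive.

Import Order.TTheory GRing.Theory Num.Theory.
Import numFieldNormedType.Exports.

Local Open Scope classical_set_scope.
Local Open Scope ring_scope.

(** The word of a tree lists the numbers of children of its vertices in
    preorder. By the cycle lemma ([sum_rot_is_code]) each word with the right sum
    has exactly one rotation that is the word of a tree; hence, for statistics
    that are invariant under rotation, a uniform tree with given degrees can be
    replaced by a uniformly shuffled word ([mean_word]). The additive functional
    of the truncation [truncate K f] is such a statistic: it is a sum, over all
    positions of the cyclic word, of a function of at most [K] consecutive
    letters, because the subtrees of size at most [K] are recognized by their
    words.

    Sums of local functions of a uniform permutation satisfy Stein's identity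
    approximately: with [Y] the normalized sum and [v] its variance,
    [Y * g Y - v * g' Y] has a small mean ([stein_identity_error]). To see this,
    the covariance of one summand with [g Y] is computed by resampling the few
    values of the permutation that the summand reads
    ([covariance_resampling]): this changes the sum boundedly, so that [g Y]
    changes by [g' Y] times the change of [Y] up to a small error, and the local
    quantity that multiplies [g' Y] is itself, by the same resampling argument,
    almost uncorrelated with [g' Y].

    The variance is computed exactly. The covariance of two occurrence counts
    involves only fringe subtrees and pairs of disjoint windows
    ([mean_occurrences_mul]). Drawing the letters of one window changes the
    probabilities for the other one by a quantity of order the inverse of the
    size; together with the number of pairs of disjoint windows, this is the origin
    of the two squares in the limiting variance ([removal_driftE], [gamma_varianceE]).

    Finally Stein's equation is solved for the limiting variance [gamma] itself
    ([stein_equation]): for [K] large the variance of the truncated functional is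
    close to [gamma], and the contribution of large subtrees is negligible by the
    second assumption ([normalized_comparison], [tree_clt_normal]). All errors
    are measured by moduli of continuity with a quadratic correction
    ([bounded_modulus]), so that they are controlled by second moments. *)

(** * Preorder degree words of trees *)

Section tree_words.
Local Open Scope nat_scope.

Lemma tree_rect_mem (P : tree -> Prop) :
  (forall s, {in s, forall t, P t} -> P (Node s)) -> forall t, P t.
Proof.
move=> H; fix IH 1; case=> s; apply: H.
elim: s => [u us|t s IHs u]; first by exfalso; rewrite in_nil in us.
by rewrite inE => /predU1P[->|/IHs].
Qed.

Definition code (t : tree) : seq nat := map root_degree (fringe t).

Definition forest_code (s : seq tree) : seq nat := flatten (map code s).

Arguments code : simpl never.
Arguments forest_code : simpl never.

Lemma code_Node s : code (Node s) = size s :: forest_code s.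
Proof. by rewrite /code /= map_flatten -map_comp. Qed.

Lemma size_code t : size (code t) = tree_size t.
Proof. by rewrite size_map. Qed.

Lemma code_gt0 t : 0 < size (code t).
Proof. by case: t => s; rewrite code_Node. Qed.

Lemma count_code c t : count_mem c (code t) = n_children t c.
Proof. by rewrite /code count_map. Qed.

(** The first letter of the word announces the number of subtrees to read
    next, so that a reader knows where the word of a tree stops. *)
Lemma code_prefix_free t t' u u' :
  code t ++ u = code t' ++ u' -> t = t' /\ u = u'.
Proof.
elim/tree_rect_mem: t t' u u' => s IHs [s'] u u'.
rewrite !code_Node !cat_cons => -[]; rewrite /forest_code.
elim: s s' IHs => [|t s IH] [|t' s'] //= IHs.
move=> [ss']; rewrite -!catA => tu.
have [<- {}tu] := IHs t (mem_head _ _) _ _ _ tu.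
have [v vs|[<-] <- //] := IH s' _ ss' tu; apply: IHs.
by rewrite inE vs orbT.
Qed.

Lemma code_inj : injective code.
Proof.
move=> t t' tt'; have := @code_prefix_free t t' [::] [::].
by rewrite !cats0 => /(_ tt')[].
Qed.

(** As vertices are visited in preorder, what follows a vertex in the word starts
    with the rest of its fringe subtree. *)
Lemma drop_code T i : i < tree_size T ->
  exists r, drop i (code T) = code (nth T (fringe T) i) ++ r.
Proof.
suff: forall T0, i < tree_size T ->
    exists r, drop i (code T) = code (nth T0 (fringe T) i) ++ r by exact.
move=> T0; elim/tree_rect_mem: T i => s IHs [|i].
  by exists [::]; rewrite drop0 cats0.
rewrite /tree_size code_Node /= ltnS /forest_code.
elim: s i IHs => [|t s IH] i IHs //=.
rewrite size_cat => ist; rewrite drop_cat nth_cat size_code /tree_size.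
case: ltnP => [it|ti].
  have [r ->] := IHs t (mem_head _ _) i it.
  by exists (r ++ flatten (map code s)); rewrite catA.
apply: IH; last by lia.
by move=> v vs; apply: IHs; rewrite inE vs orbT.
Qed.

(** Scanning a word from its root, the number of subtrees that are still
    announced must stay positive until the end of the word. *)
Lemma forest_code_surj k w : sumn w + k = size w ->
    (forall j, j < size w -> j < sumn (take j w) + k) ->
  exists2 s, size s = k & w = forest_code s.
Proof.
elim: w k => [|c w IH] k /= wk posw.
  by exists [::] => //; move: wk; rewrite add0n.
have k0 : 0 < k by have := posw 0 isT; rewrite add0n.
case: (IH (c + k.-1)) => [|j jw|s sk ->]; first by lia.
  have /= := posw j.+1; rewrite ltnS => /(_ jw); lia.
exists (Node (take c s) :: drop c s).
  by rewrite /= size_drop; lia.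
rewrite -[RHS]/(code (Node (take c s)) ++ forest_code (drop c s)).
rewrite code_Node size_takel; last by lia.
rewrite -[RHS]/(c :: (forest_code (take c s) ++ forest_code (drop c s))).
by rewrite /forest_code -[in LHS](cat_take_drop c s) map_cat flatten_cat.
Qed.

Lemma forest_code_size s : sumn (forest_code s) + size s = size (forest_code s).
Proof.
elim: s => //= t s IH; rewrite /forest_code /= sumn_cat size_cat -!/(forest_code _).
suff: sumn (code t) + 1 = size (code t) by lia.
elim/tree_rect_mem: t {IH} => {}s IHs; rewrite code_Node.
rewrite -[sumn _]/(size s + sumn (forest_code s)).
rewrite -[RHS]/((size (forest_code s)).+1).
suff: sumn (forest_code s) + size s = size (forest_code s) by lia.
elim: s IHs => //= t s IH IHs; rewrite /forest_code /= sumn_cat size_cat -!/(forest_code _).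
have := IHs t (mem_head _ _).
have : sumn (forest_code s) + size s = size (forest_code s); last by lia.
by apply: IH => v vs; apply: IHs; rewrite inE vs orbT.
Qed.

Lemma sumn_code t : sumn (code t) + 1 = size (code t).
Proof. by have := forest_code_size [:: t]; rewrite /forest_code /= cats0. Qed.

Definition is_code (w : seq nat) : bool := `[< exists t, w = code t >].

Lemma is_codeP t : is_code (code t). Proof. by apply/asboolP; exists t. Qed.

(** The rotation starts at the place where the walk with steps [c - 1] first
    reaches its minimum. *)
Lemma exists_rot_code w : sumn w + 1 = size w ->
  exists2 k, k < size w & is_code (rot k w).
Proof.
move=> ws; pose N := size w.
(* the walk, shifted by [N] to remain a natural number *)
pose S j := sumn (take j w) + (N - j).
have S0 : S 0 = N by rewrite /S take0 /= subn0.
have exS : exists m, [exists j : 'I_N, S j == m].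
  have N0 : 0 < N by rewrite /N; lia.
  by exists (S 0); apply/existsP; exists (Ordinal N0).
have [m /existsP[j0 /eqP Sj0] minm] := ex_minnP exS.
have exk : exists k, (k < N) && (S k == m).
  by exists j0; rewrite ltn_ord Sj0 eqxx.
have [k /andP[kN /eqP Sk] mink] := ex_minnP exk.
have geS j : j < N -> S k <= S j.
  by move=> jN; rewrite Sk; apply: minm; apply/existsP; exists (Ordinal jN).
have gtS j : j < k -> S k < S j.
  move=> jk; have jN := ltn_trans jk kN.
  rewrite ltn_neqAle geS // andbT; apply: contraTneq jk => jS.
  by rewrite -leqNgt; apply: mink; rewrite jN -jS Sk eqxx.
exists k => //; case: (@forest_code_surj 1 (rot k w)).
- by rewrite size_rot -ws /rot sumn_cat [sumn _ + _]addnC -sumn_cat cat_take_drop.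
- move=> j; rewrite size_rot -/N => jN.
  have sdrop i : sumn (take i (drop k w)) + sumn (take k w) = sumn (take (k + i) w).
    by rewrite addnC takeD sumn_cat.
  have sw : sumn (drop k w) + sumn (take k w) = N.-1.
    by rewrite addnC -sumn_cat cat_take_drop /N -ws addn1.
  rewrite /rot take_cat size_drop -/N; case: (ltnP j (N - k)) => jk.
    have kj : k + j < N by lia.
    by have := geS _ kj; have := sdrop j; rewrite /S; lia.
  have [jk0|jk0] := posnP (j - (N - k)).
    rewrite jk0 take0 cats0.
    have k0 : 0 < k by lia.
    by have := gtS 0 k0; rewrite S0 /S; lia.
  have jk1 : j - (N - k) < k by lia.
  rewrite sumn_cat take_takel; last by lia.
  by have := gtS _ jk1; rewrite /S; lia.
- case=> [|t [|? ?]] //= _ ->; rewrite /forest_code /= cats0; exact: is_codeP.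
Qed.

(** The rotated word would start with the word of a proper fringe subtree, which
    no longer word of a tree can have as a prefix. *)
Lemma rot_code_is_code t d : d < size (code t) -> is_code (rot d (code t)) -> d = 0.
Proof.
move=> dt /asboolP[t']; rewrite /rot.
have [|r ->] := @drop_code t d; first by rewrite -size_code.
rewrite -catA -[in RHS](cats0 (code t')) => /code_prefix_free[_].
move/(congr1 size); rewrite size_cat size_takel ?(ltnW dt) //=; lia.
Qed.

(** The cycle lemma; uniqueness is a consequence of prefix-freeness, as a
    proper suffix of the word of a tree starts with the word of a subtree. *)
Lemma sum_rot_is_code w : sumn w + 1 = size w ->
  \sum_(k < size w) is_code (rot k w) = 1.
Proof.
move=> ws; have [k kw ck] := exists_rot_code ws.
rewrite (bigD1 (Ordinal kw)) //= ck big1 ?addn0 // => l.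
rewrite -val_eqE /= => lk; apply/eqP; rewrite eqb0; apply: contra lk => cl.
suff: forall i j, i <= j -> j < size w -> is_code (rot i w) ->
    is_code (rot j w) -> i = j.
  move=> H; case: (leqP l k) => h; apply/eqP; first exact: H.
  by apply/esym/H => //; exact: ltnW.
move=> i j ij jw /asboolP[t wt].
have -> : rot j w = rot (j - i) (rot i w).
  by rewrite rot_add_mod ?size_rot; [|lia|lia]; congr rot; case: leqP; lia.
rewrite wt => /rot_code_is_code; have : size (code t) = size w by rewrite -wt size_rot.
by move=> ->; move=> H; have := H ltac:(lia); lia.
Qed.

Definition occurrences (t : tree) (w : seq nat) : nat :=
  \sum_(i < size w) prefix (code t) (rot i w).

Lemma prefix_code_nth t T i : i < tree_size T ->
  forall r, prefix (code t) (drop i (code T) ++ r) = (nth T (fringe T) i == t).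
Proof.
move=> iT r; have [r' ->] := drop_code iT; rewrite -catA.
apply/prefixP/eqP => [[u] /esym/code_prefix_free[]//|->].
by eexists.
Qed.

(** A window that starts at a vertex and extends beyond the end of the word
    still sees only the fringe subtree of that vertex. *)
Lemma occurrences_code t T : occurrences t (code T) = count_mem t (fringe T).
Proof.
rewrite /occurrences size_code.
have -> : count_mem t (fringe T) = \sum_(i < tree_size T) (nth T (fringe T) i == t).
  by rewrite -sum1_count (big_nth T) big_mkord big_mkcond /=; apply: eq_bigr => i _; case: eqP.
by apply: eq_bigr => i _; rewrite prefix_code_nth.
Qed.

End tree_words.

(** * Averages over permutations and over trees *)

Section mean.
Variables (R : realType) (T : finType).
Implicit Types (Z : T -> R) (c : R).

Definition mean Z : R := (\sum_x Z x) / #|T|%:R.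

Lemma eq_mean Z1 Z2 : Z1 =1 Z2 -> mean Z1 = mean Z2.
Proof. by move=> e; congr (_ / _); apply: eq_bigr => x _; rewrite e. Qed.

Lemma meanD Z1 Z2 : mean (fun x => Z1 x + Z2 x) = mean Z1 + mean Z2.
Proof. by rewrite /mean big_split mulrDl. Qed.

Lemma meanN Z : mean (fun x => - Z x) = - mean Z.
Proof. by rewrite /mean sumrN mulNr. Qed.

Lemma meanB Z1 Z2 : mean (fun x => Z1 x - Z2 x) = mean Z1 - mean Z2.
Proof. by rewrite meanD meanN. Qed.

Lemma meanZ c Z : mean (fun x => c * Z x) = c * mean Z.
Proof. by rewrite /mean -mulr_sumr mulrA. Qed.

Lemma meanZr c Z : mean (fun x => Z x * c) = mean Z * c.
Proof. by rewrite mulrC -meanZ; apply: eq_mean => x; rewrite mulrC. Qed.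

Lemma mean_sum (I : Type) (r : seq I) (P : pred I) (Z : I -> T -> R) :
  mean (fun x => \sum_(i <- r | P i) Z i x) = \sum_(i <- r | P i) mean (Z i).
Proof. by rewrite /mean exchange_big mulr_suml. Qed.

Lemma mean_le Z1 Z2 : (forall x, Z1 x <= Z2 x) -> mean Z1 <= mean Z2.
Proof. by move=> h; rewrite ler_wpM2r ?invr_ge0 // ler_sum. Qed.

Lemma mean_ge0 Z : (forall x, 0 <= Z x) -> 0 <= mean Z.
Proof. by move=> h; rewrite divr_ge0 // sumr_ge0. Qed.

Lemma mean_norm Z : `|mean Z| <= mean (fun x => `|Z x|).
Proof.
rewrite /mean normrM (@ger0_norm _ _^-1) ?invr_ge0 //.
rewrite ler_wpM2r ?invr_ge0 //.
exact: ler_norm_sum.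
Qed.

Lemma reindex_mean (h : T -> T) Z : bijective h -> mean Z = mean (Z \o h).
Proof.
by move=> bh; rewrite /mean (reindex h) //; apply: onW_bij.
Qed.

Hypothesis T_gt0 : (0 < #|T|)%N.

Lemma mean_cst c : mean (fun=> c) = c.
Proof.
rewrite /mean sumr_const -[c *+ _]mulr_natr mulfK // pnatr_eq0 -lt0n.
exact: T_gt0.
Qed.

End mean.

Lemma exchange_mean (R : realType) (T U : finType) (Z : T -> U -> R) :
  mean (fun x => mean (Z x)) = mean (fun y => mean (Z ^~ y)).
Proof. by rewrite /mean -!mulr_suml exchange_big mulrAC. Qed.

Section random_words.
Variables (R : realType) (n : nat) (s : 'I_n.+1 -> nat).
Local Notation N := n.+1.
Implicit Types (sigma tau : 'S_n.+1) (i k : 'I_n.+1).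

Definition word sigma : seq nat := [seq s (sigma i) | i <- enum 'I_N].

Lemma size_word sigma : size (word sigma) = N.
Proof. by rewrite size_map size_enum_ord. Qed.

Lemma nth_word sigma i : nth 0%N (word sigma) i = s (sigma i).
Proof. by rewrite (nth_map i) ?size_enum_ord // nth_ord_enum. Qed.

Lemma eq_word sigma tau :
  word sigma = word tau <-> forall i, s (sigma i) = s (tau i).
Proof.
split=> [e i|e]; first by rewrite -!nth_word e.
exact: eq_map.
Qed.

Definition rotation k : 'S_N := perm (addrI k).

Lemma rot_word k sigma : rot k (word sigma) = word (rotation k * sigma)%g.
Proof.
apply: (@eq_from_nth _ 0%N); first by rewrite size_rot !size_word.
move=> j; rewrite size_rot size_word => jN.
rewrite (nth_word _ (Ordinal jN)) permM permE -nth_word /=.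
rewrite /rot nth_cat size_drop size_word; case: ltnP => jk.
  by rewrite nth_drop modn_small //; lia.
rewrite nth_take; last by have := ltn_ord k; lia.
have -> : (k + j = (j - (N - k)) + N)%N by have := ltn_ord k; lia.
by rewrite modnDr modn_small //; have := ltn_ord k; lia.
Qed.

Hypothesis sum_s : (\sum_i s i + 1 = N)%N.

Lemma sumn_word sigma : (sumn (word sigma) + 1 = size (word sigma))%N.
Proof.
rewrite size_word -[RHS]sum_s sumnE big_map big_enum /=.
by rewrite [in RHS](reindex_inj (@perm_inj _ sigma)).
Qed.

(** Each word is carried by exactly one rotation to the word of a tree, and
    rotations preserve the uniform measure on permutations. *)
Lemma sum_is_code (Psi : seq nat -> R) :
    (forall k sigma, Psi (rot k (word sigma)) = Psi (word sigma)) ->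
  \sum_sigma Psi (word sigma) =
    N%:R * \sum_(sigma | is_code (word sigma)) Psi (word sigma).
Proof.
move=> rotPsi.
under eq_bigr => sigma _.
  rewrite -[Psi _]mulr1 -[X in _ * X]/(1%N%:R).
  rewrite -(sum_rot_is_code (sumn_word sigma)) size_word natr_sum mulr_sumr.
  under eq_bigr => k _ do rewrite -(rotPsi k) rot_word.
  over.
have NE : N%:R = \sum_(k < N) 1 :> R by rewrite sumr_const card_ord.
rewrite exchange_big /= [in RHS]NE mulr_suml.
apply: eq_bigr => k _; rewrite mul1r [RHS]big_mkcond /=.
rewrite [RHS](reindex_inj (mulgI (rotation k))) /=.
by apply: eq_bigr => sigma _; case: is_code; rewrite ?mulr1 ?mulr0.
Qed.

Variable A : set tree.
Hypothesis codeA : forall t, A t <-> exists sigma, code t = word sigma.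

Lemma finite_codeA : finite_set A.
Proof.
pose decode w := xget (Node [::]) [set t | code t = w].
apply: (@sub_finite_set _ _ ((fun sigma => decode (word sigma)) @` setT)).
  move=> t /codeA[sigma et]; exists sigma => //.
  rewrite /decode -et; case: xgetP => [u _ /= /code_inj //|/(_ t)].
  by case.
by apply: finite_image; exact: finite_finset.
Qed.

Definition tree_mean (g : tree -> R) : R :=
  (\sum_(t <- fset_set A) g t) / (#|` fset_set A|)%:R.

(** All arrangements of the letters are hit by the same number of
    permutations, those arrangements that are words of trees in
    particular. *)
Lemma mean_word (Psi : seq nat -> R) :
    (forall k sigma, Psi (rot k (word sigma)) = Psi (word sigma)) ->
  mean (fun sigma => Psi (word sigma)) = tree_mean (fun t => Psi (code t)).
Proof.
move=> rotPsi.
pose c t := (\sum_(sigma | word sigma == code t) 1)%N.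
have [c0 c0E] : exists c0, forall t, A t -> c t = c0.
  have [[t0 At0]|noA] := pselect (exists t, A t); last first.
    by exists 0%N => t At; case: noA; exists t.
  exists (c t0) => t /codeA[tau et]; have /codeA[tau0 et0] := At0.
  rewrite /c (reindex_inj (mulgI (tau * tau0^-1)%g)) et et0.
  apply: eq_bigl => sigma; apply/eqP/eqP => /eq_word e; apply/eq_word => i.
    by have := e (tau^-1%g (tau0 i)); rewrite !permM permKV permK.
  by rewrite !permM e permKV.
have key Phi : \sum_(sigma | is_code (word sigma)) Phi (word sigma) =
    c0%:R * \sum_(t <- fset_set A) Phi (code t) :> R.
  rewrite mulr_sumr.
  transitivity (\sum_(t <- fset_set A)
      \sum_(sigma | word sigma == code t) Phi (word sigma)); last first.
    apply: eq_big_seq => t; rewrite in_fset_set; last exact: finite_codeA.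
    rewrite inE => /c0E <-; rewrite /c natr_sum mulr_suml.
    apply: eq_big => sigma; rewrite ?inE // => /eqP ->.
    by rewrite mul1r.
  rewrite big_mkcond /=; under [RHS]eq_bigr do rewrite big_mkcond /=.
  rewrite exchange_big /=; apply: eq_bigr => sigma _.
  case: ifPn => [/asboolP[t et]|nc].
    have tA : t \in fset_set A.
      rewrite in_fset_set; last exact: finite_codeA.
      by rewrite inE; apply/codeA; exists sigma.
    rewrite (bigD1_seq t) ?fset_uniq //= et eqxx big1 ?addr0 // => u ut.
    by case: eqP => // /code_inj ut'; rewrite ut' eqxx in ut.
  rewrite big1 // => t _; case: eqP => // et.
  by case/asboolP: nc; exists t.
have card_S : (#|{: 'S_N}|%:R = N%:R * (c0%:R * (#|` fset_set A|)%:R) :> R).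
  have := @sum_is_code (fun=> 1) (fun _ _ => erefl).
  rewrite (key (fun=> 1)) sumr_const => ->.
  by rewrite big_const_seq count_predT iter_addr addr0.
have : (#|{: 'S_N}|%:R : R) != 0.
  by rewrite pnatr_eq0 -lt0n; apply/card_gt0P; exists 1%g.
rewrite card_S !mulf_eq0 !negb_or => /and3P[N0 c00 A0].
rewrite /mean sum_is_code // key card_S /tree_mean -!mulf_div.
by rewrite !divff // !mul1r.
Qed.

End random_words.

(** * Resampling a few values of a random permutation *)

Section resampling.
Variables (R : realType) (n : nat).
Local Notation N := n.+1.
Local Notation perms := {perm 'I_N}.
Local Open Scope set_scope.
Local Open Scope ring_scope.
Implicit Types (sigma tau pi : perms) (V : {set 'I_N}) (q Z : perms -> R).

Lemma perms_gt0 : (0 < #|{: perms}|)%N.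
Proof. by apply/card_gt0P; exists 1%g. Qed.

Lemma mean_mull tau Z : mean (fun sigma => Z (tau * sigma)%g) = mean Z.
Proof. by rewrite [RHS](reindex_mean _ (h := mulg tau)) //; exact: injF_bij (mulgI tau). Qed.

Lemma mean_mulr tau Z : mean (fun sigma => Z (sigma * tau)%g) = mean Z.
Proof. by rewrite [RHS](reindex_mean _ (h := mulg^~ tau)) //; exact: injF_bij (mulIg tau). Qed.

Lemma mean_perm_eq (u v : 'I_N) :
  mean (fun pi : perms => (pi u == v)%:R) = N%:R^-1 :> R.
Proof.
have eqv v' : mean (fun pi : perms => (pi u == v')%:R) =
              mean (fun pi : perms => (pi u == v)%:R) :> R.
  rewrite -(mean_mulr (tperm v v')); apply: eq_mean => pi; congr (_%:R).
  by rewrite permM -[X in _ == X](tpermL v v') (inj_eq perm_inj).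
have : \sum_(v' < N) mean (fun pi : perms => (pi u == v')%:R) = 1 :> R.
  rewrite -mean_sum -[RHS](mean_cst perms_gt0); apply: eq_mean => pi.
  rewrite (bigD1 (pi u)) //= eqxx big1 ?addr0 // => v' /negbTE.
  by rewrite eq_sym => ->.
under eq_bigr do rewrite eqv.
rewrite sumr_const card_ord -[_ *+ _]mulr_natr => h.
by apply: (mulIf (x := N%:R)); rewrite ?pnatr_eq0 // h mulVf ?pnatr_eq0.
Qed.

Definition displaced V pi := [forall u in V, pi u \notin V].

(** Union bound over the pairs of points of [V]. *)
Lemma mean_not_displaced V :
  mean (fun pi => (~~ displaced V pi)%:R) <= #|V|%:R ^+ 2 / N%:R :> R.
Proof.
apply: (@le_trans _ _ (mean (fun pi => \sum_(u in V) \sum_(v in V) (pi u == v)%:R))).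
  apply: mean_le => pi; have [_|] := boolP (displaced V pi).
    by rewrite !sumr_ge0 // => *; rewrite sumr_ge0.
  move=> /forall_inPn[u uV]; rewrite negbK => piuV.
  rewrite (bigD1 u) //= (bigD1 (pi u)) //= eqxx -addrA lerDl.
  by rewrite addr_ge0 // ?sumr_ge0 // => *; rewrite sumr_ge0.
rewrite mean_sum; under eq_bigr => u _ do rewrite mean_sum.
under eq_bigr => u _ do under eq_bigr => v _ do rewrite mean_perm_eq.
under eq_bigr do rewrite sumr_const.
by rewrite sumr_const -mulrnA -[leLHS]mulr_natr natrM expr2 mulrC.
Qed.

Definition swap_fun V pi (x : 'I_N) : 'I_N :=
  if x \in V then pi x else if pi^-1%g x \in V then pi^-1%g x else x.

(** [swap_fun V pi] is a permutation, and then an involution, when [V] is displaced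
    by [pi]; the choice operator provides a total definition, with the identity as
    default value in the other cases. *)
Definition swap V pi : perms :=
  odflt 1%g [pick b : perms | [forall x, b x == swap_fun V pi x]].

Lemma swapE V pi : displaced V pi -> swap V pi =1 swap_fun V pi.
Proof.
move=> /forall_inP piV; rewrite /swap; case: pickP => [b /forallP h x|/=].
  exact/eqP.
have swapK : involutive (swap_fun V pi).
  move=> x; rewrite {2}/swap_fun; case: ifPn => [xV|xV].
    by rewrite /swap_fun (negbTE (piV _ xV)) permK xV.
  case: ifPn => [xV'|xV']; first by rewrite /swap_fun xV' permKV.
  by rewrite /swap_fun (negbTE xV) (negbTE xV').
move=> /(_ (perm (inv_inj swapK)))/negbT/forallPn[x].
by rewrite permE eqxx.
Qed.

Lemma swap_involutive V pi : displaced V pi -> (swap V pi * swap V pi = 1)%g.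
Proof.
move=> Vpi; apply/permP => x; rewrite permM perm1 !swapE //.
move/forall_inP : Vpi => piV; rewrite {2}/swap_fun; case: ifPn => [xV|xV].
  by rewrite /swap_fun (negbTE (piV _ xV)) permK xV.
case: ifPn => [xV'|xV']; first by rewrite /swap_fun xV' permKV.
by rewrite /swap_fun (negbTE xV) (negbTE xV').
Qed.

Definition moved tau : {set 'I_N} := [set x | tau x != x].

Lemma card_moved_swap V pi : (#|moved (swap V pi)| <= 2 * #|V|)%N.
Proof.
apply: (@leq_trans #|V :|: pi @: V|); last first.
  by rewrite mul2n -addnn (leq_trans (leq_card_setU _ _)) // leq_add2l leq_imset_card.
apply/subset_leq_card/fintype.subsetP => x; rewrite !inE /swap.
case: pickP => [b /forallP /(_ x) /eqP -> |_]; last by rewrite perm1 eqxx.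
rewrite /swap_fun; case: ifP => //= _; case: ifP => [xV _|]; last by rewrite eqxx.
by apply/imsetP; exists (pi^-1%g x) => //; rewrite permKV.
Qed.

Definition depends_on V q :=
  forall sigma tau, {in V, sigma =1 tau} -> q sigma = q tau.

Definition perm_covariance q Z := mean (fun sigma => q sigma * Z sigma) - mean q * mean Z.

(** The product [pi * sigma] is uniform and independent of [sigma] when [pi] is
    uniform and independent of [sigma]. *)
Lemma perm_covarianceE q Z : perm_covariance q Z =
  mean (fun pi => mean (fun sigma => (q sigma - q (pi * sigma)%g) * Z sigma)).
Proof.
rewrite exchange_mean /perm_covariance.
rewrite -meanZ -meanB; apply: eq_mean => sigma.
by rewrite meanZr meanB (mean_cst perms_gt0) mean_mulr mulrBl.
Qed.

(** When [q] reads a permutation on [V] only, replacing [sigma] by an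
    independent permutation inside [q] can be done by a swap of few values, and
    this swap can be moved from [q] to [Z]. *)
Lemma covariance_resampling V q Z (b : R) :
    depends_on V q -> (forall sigma, `|q sigma| <= b) ->
  `|perm_covariance q Z - mean (fun pi => (displaced V pi)%:R *
      mean (fun sigma => q sigma * (Z sigma - Z (swap V pi * sigma)%g)))|
  <= 2 * b * (#|V|%:R ^+ 2 / N%:R) * mean (fun sigma => `|Z sigma|).
Proof.
move=> qV qb; have b0 : 0 <= b := le_trans (normr_ge0 _) (qb 1%g).
rewrite perm_covarianceE -meanB.
apply: (le_trans (mean_norm _)).
apply: (@le_trans _ _ (mean (fun pi => (~~ displaced V pi)%:R *
   (2 * b * mean (fun sigma => `|Z sigma|))))); last first.
  rewrite meanZr mulrC [leRHS]mulrAC ler_wpM2l ?mean_not_displaced //.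
  by apply: mulr_ge0; [exact: mulr_ge0|exact: mean_ge0].
apply: mean_le => pi; have [piV|piV] /= := boolP (displaced V pi); last first.
  rewrite mul0r mul1r subr0 (le_trans (mean_norm _)) // -meanZ.
  apply: mean_le => sigma; rewrite normrM ler_wpM2r //.
  by rewrite (le_trans (ler_normB _ _)) // mulr_natl mulr2n lerD.
rewrite mul1r mul0r -meanB.
rewrite [X in `|X|](_ : _ = mean (fun sigma => q sigma * Z (swap V pi * sigma)%g) -
    mean (fun sigma => q (pi * sigma)%g * Z sigma)); last first.
  by rewrite -meanB; apply: eq_mean => sigma; ring.
set x := mean _; set y := mean _.
suff -> : x = y by rewrite subrr normr0.
rewrite /x -(mean_mull (swap V pi)); apply: eq_mean => sigma.
rewrite mulgA swap_involutive // mul1g; congr (_ * _).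
by apply: qV => u uV; rewrite !permM swapE // /swap_fun uV.
Qed.

End resampling.

(** * Normal approximation of sums of local functions *)

Section normal_approximation.
Variables (R : realType) (n : nat).
Local Notation N := n.+1.
Local Notation perms := {perm 'I_N}.
Local Open Scope set_scope.
Local Open Scope ring_scope.
Implicit Types (sigma tau pi : perms) (i j : 'I_N) (V : {set 'I_N}) (q Z : perms -> R).
Variables (U : 'I_N -> {set 'I_N}) (h : 'I_N -> perms -> R) (m : nat) (B : R).
Hypothesis cardU : forall i, (#|U i| <= m)%N.
Hypothesis card_covering : forall x, (\sum_(i | x \in U i) 1 <= m)%N.
Hypothesis hU : forall i, depends_on (U i) (h i).
Hypothesis hB : forall i sigma, `|h i sigma| <= B.

Let B0 : 0 <= B. Proof. exact: le_trans (normr_ge0 _) (hB ord0 1%g). Qed.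

Definition total sigma := \sum_i h i sigma.

Lemma total_lipschitz tau sigma :
  `|total sigma - total (tau * sigma)%g| <= 2 * B * m%:R * #|moved tau|%:R.
Proof.
rewrite /total -sumrB (le_trans (ler_norm_sum _ _ _)) //.
apply: (@le_trans _ _ (\sum_i \sum_(x in moved tau) (2 * B) * (x \in U i)%:R)).
  apply: ler_sum => i _.
  have [/exists_inP[x xm xU]|/exists_inPn nU] := boolP [exists x in moved tau, x \in U i].
    rewrite (bigD1 x) //= xU mulr1 ler_wpDr ?sumr_ge0 // => [y _|].
      by rewrite !mulr_ge0.
    by rewrite (le_trans (ler_normB _ _)) // mulr_natl mulr2n lerD.
  rewrite (hU (tau := (tau * sigma)%g)) ?subrr ?normr0 ?sumr_ge0 //.
    by move=> y _; rewrite !mulr_ge0.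
  move=> x xU; rewrite permM; have /contraL/(_ xU) := nU x.
  by rewrite inE negbK => /eqP ->.
rewrite exchange_big /= [leRHS](_ : _ = \sum_(x in moved tau) 2 * B * m%:R).
  2: by rewrite sumr_const mulr_natr.
apply: ler_sum => x _; rewrite -mulr_sumr ler_wpM2l ?mulr_ge0 //.
by rewrite -natr_sum ler_nat -big_mkcond card_covering.
Qed.

(* bounds the change of the total under a swap of one window *)
Let D : R := 4 * B * m%:R ^+ 2.
(* bounds the number of places on which this change depends: the window itself,
   and both images under the swap of the at most [2 * m * m] windows that meet
   one of its at most [2 * m] moved points *)
Let L : nat := (m + 4 * m ^ 3)%N.

Lemma total_swap_le (V : {set 'I_N}) pi sigma v : (#|V| <= v)%N ->
  `|total sigma - total (swap V pi * sigma)%g| <= 4 * B * m%:R * v%:R.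
Proof.
move=> Vv; apply: (le_trans (total_lipschitz _ _)).
have /(leq_trans (card_moved_swap V pi)) : (2 * #|V| <= 2 * v)%N by rewrite leq_mul2l Vv orbT.
rewrite -(ler_nat R) natrM => /(ler_wpM2l (_ : 0 <= 2 * B * m%:R)) H.
by apply: (le_trans (H _)); rewrite ?mulr_ge0 // le_eqVlt; apply/orP; left; apply/eqP; ring.
Qed.

(** The mean of [gain i] over [pi] and [sigma] is essentially the covariance of
    [h i] with [total]. *)
Definition gain i pi sigma :=
  h i sigma * (total sigma - total (swap (U i) pi * sigma)%g).

Definition gain_support i pi : {set 'I_N} :=
  let tau := swap (U i) pi in
  U i :|: \bigcup_(j | [exists x in moved tau, x \in U j]) (U j :|: tau @: U j).

(** A window that meets no moved point contributes the same value before and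
    after the swap. *)
Lemma depends_on_gain i pi : depends_on (gain_support i pi) (gain i pi).
Proof.
move=> sigma tau e; rewrite /gain (hU (tau := tau)); last first.
  by move=> x xU; rewrite e // inE xU.
congr (_ * _); rewrite /total -!sumrB; apply: eq_bigr => j _.
have [/existsP[x xj]|nU] := boolP [exists x in moved (swap (U i) pi), x \in U j].
  have sub : {subset U j :|: swap (U i) pi @: U j <= gain_support i pi}.
    move=> y yU; rewrite inE; apply/orP; right; apply/bigcupP.
    by exists j => //; apply/existsP; exists x.
  congr (_ - _); apply: hU => y yU; first by apply/e/sub; rewrite inE yU.
  by rewrite !permM; apply/e/sub; rewrite inE imset_f ?orbT.
suff h_swap rho : h j (swap (U i) pi * rho)%g = h j rho by rewrite !h_swap !subrr.
apply: hU => y yU; have /exists_inPn/(_ y)/contraL/(_ yU) := nU.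
by rewrite inE negbK permM => /eqP ->.
Qed.

Lemma card_gain_support i pi : (#|gain_support i pi| <= L)%N.
Proof.
rewrite (leq_trans (leq_card_setU _ _)) // leq_add //.
set tau := swap _ _.
apply: (@leq_trans (\sum_(j | [exists x in moved tau, x \in U j]) 2 * m)).
  elim/big_rec2: _ => [|j k A _ Ak]; first by rewrite cards0.
  rewrite (leq_trans (leq_card_setU _ _)) // leq_add //.
  rewrite (leq_trans (leq_card_setU _ _)) // mul2n -addnn leq_add //.
  by rewrite (leq_trans (leq_imset_card _ _)).
under eq_bigr do rewrite -[(2 * m)%N]mul1n.
rewrite -big_distrl /=.
have : (\sum_(j | [exists x in moved tau, x \in U j]) 1 <= 2 * m * m)%N.
  apply: (@leq_trans (\sum_(x in moved tau) \sum_(j | x \in U j) 1)%N).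
    rewrite (exchange_big_dep xpredT) //= big_mkcond; apply: leq_sum => j _.
    case: ifP => // /exists_inP[x xm xU]; rewrite (bigD1 x) //=.
    by rewrite xm xU.
  apply: (@leq_trans (\sum_(x in moved tau) m)); first exact: leq_sum.
  rewrite sum_nat_const leq_mul2r; apply/orP; right.
  by rewrite (leq_trans (card_moved_swap _ _)) // leq_mul2l cardU orbT.
by move=> H; rewrite (leq_trans (leq_mul H (leqnn _))) //; nia.
Qed.

Lemma gain_le i pi sigma : `|gain i pi sigma| <= B * D.
Proof.
rewrite normrM ler_pM // (le_trans (total_swap_le _ _ (cardU i))) //.
by rewrite /D expr2 !mulrA.
Qed.

Definition fluctuation sigma := (total sigma - mean total) / Num.sqrt N%:R.
Local Notation Y := fluctuation.
Definition fluctuation_var := mean (fun sigma => Y sigma ^+ 2).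
Local Notation v2 := fluctuation_var.

Let sqrtN_gt0 : 0 < Num.sqrt N%:R :> R. Proof. by rewrite sqrtr_gt0 ltr0n. Qed.
Let sqrtN_neq0 : Num.sqrt N%:R != 0 :> R. Proof. by rewrite gt_eqF. Qed.
Let sqrtNE : Num.sqrt N%:R ^+ 2 = N%:R :> R. Proof. by rewrite sqr_sqrtr ?ler0n. Qed.

Let v2_ge0 : 0 <= v2. Proof. by apply: mean_ge0 => s; rewrite sqr_ge0. Qed.

Lemma mean_abs_fluctuation : mean (fun sigma => `|Y sigma|) <= 1 + v2.
Proof.
rewrite -[1](@mean_cst R _ (perms_gt0 n)) -meanD; apply: mean_le => sigma.
have := sqr_ge0 (`|Y sigma| - 1); rewrite sqrrB real_normK ?num_real //.
have := normr_ge0 (Y sigma); nra.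
Qed.

Lemma fluctuation_swap_le (V : {set 'I_N}) pi sigma v : (#|V| <= v)%N ->
  `|Y sigma - Y (swap V pi * sigma)%g| <= 4 * B * m%:R * v%:R / Num.sqrt N%:R.
Proof.
move=> Vv; rewrite /Y -mulrBl opprB addrA addrNK normrM.
by rewrite (@ger0_norm _ _^-1) ?invr_ge0 ?sqrtr_ge0 // ler_wpM2r ?invr_ge0 ?sqrtr_ge0 // total_swap_le.
Qed.

Definition swap_sum (Z : perms -> R) := \sum_i mean (fun pi =>
  (displaced (U i) pi)%:R *
  mean (fun sigma => h i sigma * (Z sigma - Z (swap (U i) pi * sigma)%g))).

Lemma sum_covariance (Z : perms -> R) :
  \sum_i perm_covariance (h i) Z = Num.sqrt N%:R * mean (fun sigma => Y sigma * Z sigma).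
Proof.
rewrite -meanZ; under [RHS]eq_mean => sigma.
  rewrite mulrA [_ * Y _]mulrC /Y divfK // mulrBl /total mulr_suml.
  over.
rewrite meanB meanZ mean_sum sumrB; congr (_ - _).
by rewrite /total mean_sum mulr_suml.
Qed.

Lemma swap_sum_approx (Z : perms -> R) :
  `|Num.sqrt N%:R * mean (fun sigma => Y sigma * Z sigma) - swap_sum Z|
  <= 2 * B * m%:R ^+ 2 * mean (fun sigma => `|Z sigma|).
Proof.
rewrite -sum_covariance /swap_sum -sumrB (le_trans (ler_norm_sum _ _ _)) //.
apply: (@le_trans _ _ (\sum_(i < N) (2 * B * (m%:R ^+ 2 / N%:R) * mean (fun sigma => `|Z sigma|)))).
  apply: ler_sum => i _; have := covariance_resampling Z (@hU i) (hB i).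
  move=> H; apply: (le_trans H).
  rewrite ler_wpM2r ?mean_ge0 // ler_wpM2l ?mulr_ge0 // ler_wpM2r ?invr_ge0 ?ler0n //.
  by rewrite ler_pXn2r ?nnegrE ?ler0n // ler_nat.
rewrite sumr_const card_ord -mulr_natr le_eqVlt; apply/orP; left; apply/eqP.
by field; rewrite addrC natr1 pnatr_eq0.
Qed.

Section smooth_test_function.
Variables (f f' : R -> R) (M C eps : R).
Hypothesis fM : forall x, `|f x| <= M.
Hypothesis f'M : forall x, `|f' x| <= M.
Hypothesis eps_ge0 : 0 <= eps.
Hypothesis C_ge0 : 0 <= C.
Hypothesis f_taylor : forall x y,
  `|f x - f y - f' x * (x - y)| <= (eps * (1 + x ^+ 2) + C * (x - y) ^+ 2) * `|x - y|.
Hypothesis f'_modulus : forall x y,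
  `|f' x - f' y| <= eps * (1 + x ^+ 2) + C * (x - y) ^+ 2.

Let M_ge0 : 0 <= M. Proof. exact: le_trans (normr_ge0 _) (fM 0). Qed.

Let mean_modulus c : mean (fun sigma => eps * (1 + Y sigma ^+ 2) + c) = eps * (1 + v2) + c.
Proof. by rewrite meanD meanZ meanD !(mean_cst (perms_gt0 n)). Qed.

Let sqr_swap_le V pi sigma v : (#|V| <= v)%N ->
  (Y sigma - Y (swap V pi * sigma)%g) ^+ 2 <= (4 * B * m%:R * v%:R) ^+ 2 / N%:R.
Proof.
move=> /(fluctuation_swap_le pi sigma) H.
rewrite -sqrtNE -expr_div_n -real_normK ?num_real //.
by rewrite ler_pXn2r // ?nnegrE ?divr_ge0 ?mulr_ge0.
Qed.

(** Resampling the places that [q] reads hardly changes the fluctuation. Applied to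
    the gains, this decouples them from the derivative in Stein's identity. *)
Lemma covariance_smooth_le V q (b : R) : (#|V| <= L)%N -> depends_on V q ->
    (forall sigma, `|q sigma| <= b) ->
  `|perm_covariance q (f' \o Y)| <=
  b * (2 * L%:R ^+ 2 * M / N%:R + eps * (1 + v2) + C * (4 * B * m%:R * L%:R) ^+ 2 / N%:R).
Proof.
move=> VL qV qb; have b0 : 0 <= b := le_trans (normr_ge0 _) (qb 1%g).
have := covariance_resampling (f' \o Y) qV qb; set main := mean _ => H.
have H1 : `|main| <= b * (eps * (1 + v2) + C * (4 * B * m%:R * L%:R) ^+ 2 / N%:R).
  rewrite -mean_modulus -meanZ (le_trans (mean_norm _)) //.
  rewrite -[leRHS](@mean_cst R _ (perms_gt0 n)); apply: mean_le => pi.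
  rewrite normrM; apply: (@le_trans _ _ (1 * `|mean (fun sigma => q sigma *
      ((f' \o Y) sigma - (f' \o Y) (swap V pi * sigma)%g))|)).
    by rewrite ler_wpM2r // ger0_norm // lern1 leq_b1.
  rewrite mul1r (le_trans (mean_norm _)) //; apply: mean_le => sigma.
  rewrite normrM ler_pM // (le_trans (f'_modulus _ _)) // lerD2l -mulrA.
  by rewrite ler_wpM2l // sqr_swap_le.
have H2 : 2 * b * (#|V|%:R ^+ 2 / N%:R) * mean (fun sigma => `|(f' \o Y) sigma|)
    <= 2 * b * (L%:R ^+ 2 / N%:R) * M.
  apply: ler_pM => //.
  - by rewrite !mulr_ge0 // ?invr_ge0 ?exprn_ge0.
  - exact: mean_ge0.
  - rewrite ler_wpM2l ?mulr_ge0 // ler_wpM2r ?invr_ge0 // ler_pXn2r ?nnegrE //.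
    by rewrite ler_nat.
  - by rewrite -[leRHS](@mean_cst R _ (perms_gt0 n)); apply: mean_le => sigma; exact: f'M.
have := ler_normD (perm_covariance q (f' \o Y) - main) main; rewrite subrK => H3.
apply: (le_trans H3); apply: (le_trans (lerD (le_trans H H2) H1)).
by rewrite le_eqVlt; apply/orP; left; apply/eqP; ring.
Qed.

Let total_gain := \sum_i mean (fun pi => (displaced (U i) pi)%:R * mean (gain i pi)).

Let swap_sum_fluctuation : swap_sum Y = total_gain / Num.sqrt N%:R.
Proof.
rewrite /total_gain mulr_suml; apply: eq_bigr => i _.
rewrite -meanZr; apply: eq_mean => pi; rewrite -mulrA; congr (_ * _).
rewrite -meanZr; apply: eq_mean => sigma; rewrite /gain /Y.
by rewrite -mulrBl opprB addrA addrNK mulrA.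
Qed.

(** Each increment of [f] is linearized, then the gain and the derivative are
    decoupled. *)
Lemma swap_sum_smooth :
  `|swap_sum (f \o Y) - total_gain / Num.sqrt N%:R * mean (f' \o Y)| <=
  Num.sqrt N%:R * (B * D * (2 * eps * (1 + v2) +
    (C * (D ^+ 2 + (4 * B * m%:R * L%:R) ^+ 2) + 2 * L%:R ^+ 2 * M) / N%:R)).
Proof.
rewrite /total_gain !mulr_suml -sumrB (le_trans (ler_norm_sum _ _ _)) //.
have -> : Num.sqrt N%:R * (B * D * (2 * eps * (1 + v2) +
    (C * (D ^+ 2 + (4 * B * m%:R * L%:R) ^+ 2) + 2 * L%:R ^+ 2 * M) / N%:R)) =
  \sum_(i < N) (B * (D / Num.sqrt N%:R) * (eps * (1 + v2) + C * D ^+ 2 / N%:R) +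
    (B * D) * (2 * L%:R ^+ 2 * M / N%:R + eps * (1 + v2) +
                C * (4 * B * m%:R * L%:R) ^+ 2 / N%:R) / Num.sqrt N%:R).
  rewrite sumr_const card_ord -[RHS]mulr_natr -[X in _ = _ * X]sqrtNE expr2.
  rewrite [RHS]mulrA; set r := Num.sqrt _; set iN := _^-1.
  by field; exact: sqrtN_neq0.
apply: ler_sum => i _; rewrite -!meanZr -meanB (le_trans (mean_norm _)) //.
rewrite -[leRHS](@mean_cst R _ (perms_gt0 n)); apply: mean_le => pi.
set A := mean (fun sigma => h i sigma * _).
rewrite (_ : _ - _ = (displaced (U i) pi)%:R *
  (A - mean (gain i pi) * ((Num.sqrt N%:R)^-1 * mean (f' \o Y)))); last by ring.
rewrite normrM; set E := `|_ - _|; apply: (@le_trans _ _ (1 * E)).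
  apply: ler_wpM2r; first exact: normr_ge0.
  by rewrite ger0_norm // lern1 leq_b1.
rewrite mul1r {}/E.
pose A' := mean (fun sigma => gain i pi sigma * (f' \o Y) sigma) / Num.sqrt N%:R.
have -> : A - mean (gain i pi) * ((Num.sqrt N%:R)^-1 * mean (f' \o Y)) =
    (A - A') + perm_covariance (gain i pi) (f' \o Y) / Num.sqrt N%:R.
  by rewrite /A' /perm_covariance; ring.
rewrite (le_trans (ler_normD _ _)) // lerD //; last first.
  rewrite normrM (@ger0_norm _ _^-1) ?invr_ge0 ?sqrtr_ge0 // ler_wpM2r ?invr_ge0 ?sqrtr_ge0 //.
  exact: (covariance_smooth_le (card_gain_support i pi) (@depends_on_gain i pi) (gain_le i pi)).
rewrite /A /A' -meanZr -meanB (le_trans (mean_norm _)) //.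
rewrite -mean_modulus -meanZ; apply: mean_le => sigma.
have dY : `|Y sigma - Y (swap (U i) pi * sigma)%g| <= D / Num.sqrt N%:R.
  by have := fluctuation_swap_le pi sigma (cardU i); rewrite /D expr2 !mulrA.
have -> : h i sigma * ((f \o Y) sigma - (f \o Y) (swap (U i) pi * sigma)%g) -
    gain i pi sigma * (f' \o Y) sigma / Num.sqrt N%:R =
  h i sigma * (f (Y sigma) - f (Y (swap (U i) pi * sigma)%g) -
    f' (Y sigma) * (Y sigma - Y (swap (U i) pi * sigma)%g)).
  by rewrite /gain /= /Y; ring.
rewrite normrM -[leRHS]mulrA; apply: ler_pM => //.
apply: (le_trans (f_taylor _ _)); rewrite mulrC; apply: ler_pM => //.
  by apply: addr_ge0; rewrite mulr_ge0 ?sqr_ge0 // addr_ge0 ?sqr_ge0.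
rewrite lerD2l -mulrA; apply: ler_wpM2l => //.
by have := sqr_swap_le pi sigma (cardU i); rewrite /D -[in X in X -> _]mulrA -expr2.
Qed.

Definition stein_constant : R :=
  4 * B * m%:R ^+ 2 + B * D * (2 + D ^+ 2 + (4 * B * m%:R * L%:R) ^+ 2 + 2 * L%:R ^+ 2).

(** The case of the identity function in [swap_sum_approx] shows that the total gain
    is close to [N] times the variance; this is substituted in
    [swap_sum_smooth]. *)
Lemma stein_identity_error :
  `|mean (fun sigma => Y sigma * f (Y sigma)) - v2 * mean (f' \o Y)| <=
  stein_constant * (1 + v2) * (eps + (M + C) / Num.sqrt N%:R).
Proof.
have r0 := sqrtN_gt0; set r := Num.sqrt _ in r0 *.
have rN : N%:R = r ^+ 2 by rewrite sqrtNE.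
have H1 := swap_sum_approx (f \o Y).
have H2 := swap_sum_approx Y.
have H3 := swap_sum_smooth.
have H4 : mean (fun sigma => `|(f \o Y) sigma|) <= M.
  by rewrite -[leRHS](@mean_cst R _ (perms_gt0 n)); apply: mean_le => s; exact: fM.
have H5 := mean_abs_fluctuation.
have H6 : `|mean (f' \o Y)| <= M.
  by rewrite (le_trans (mean_norm _)) // -[leRHS](@mean_cst R _ (perms_gt0 n)); apply: mean_le => s; exact: f'M.
rewrite swap_sum_fluctuation in H2.
have -> : mean (fun sigma => Y sigma * f (Y sigma)) - v2 * mean (f' \o Y) =
  r^-1 * ((r * mean (fun sigma => Y sigma * (f \o Y) sigma) - swap_sum (f \o Y)) +
    (swap_sum (f \o Y) - total_gain / r * mean (f' \o Y)) -
    (r * mean (fun sigma => Y sigma * Y sigma) - total_gain / r) * mean (f' \o Y)).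
  have -> : mean (fun sigma => Y sigma * Y sigma) = v2 by apply: eq_mean => s; rewrite expr2.
  rewrite -[mean (fun sigma => Y sigma * (f \o Y) sigma)]/(mean (fun sigma => Y sigma * f (Y sigma))).
  by field; rewrite gt_eqF.
rewrite normrM gtr0_norm ?invr_gt0 // -ler_pdivlMl ?invr_gt0 // invrK.
rewrite (le_trans (ler_normB _ _)) // normrM.
have m2 : 0 <= 2 * B * m%:R ^+ 2 by rewrite !mulr_ge0 ?exprn_ge0.
have K2 := ler_pM (normr_ge0 _) (normr_ge0 _) (le_trans H2 (ler_wpM2l m2 H5)) H6.
have K1 := le_trans H1 (ler_wpM2l m2 H4).
rewrite (le_trans (lerD (le_trans (ler_normD _ _) (lerD K1 H3)) K2)) //.
rewrite -/r rN.
have D0 : 0 <= D by rewrite !mulr_ge0 ?exprn_ge0.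
have irr : r * (r ^+ 2)^-1 <= 1.
  rewrite expr2 invfM mulrA mulfV ?gt_eqF // mul1r invf_le1 //.
  by rewrite -[1]sqrtr1 ler_wsqrtr // ler1n.
set x := (r ^+ 2)^-1 in irr *.
have x0 : 0 <= x by rewrite invr_ge0 sqr_ge0.
have rx : r * ((M + C) / r) = M + C by field; rewrite gt_eqF.
have -> : r * (stein_constant * (1 + v2) * (eps + (M + C) / r)) =
  stein_constant * (1 + v2) * (r * eps + (M + C)) by rewrite -[in RHS]rx; ring.
rewrite /stein_constant.
set a := 2 * B * m%:R ^+ 2 in m2 *.
have -> : 4 * B * m%:R ^+ 2 = 2 * a by rewrite /a; ring.
set u := B * D; have u0 : 0 <= u by rewrite mulr_ge0.
set w := (4 * B * _ * _) ^+ 2; have w0 : 0 <= w by rewrite sqr_ge0.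
set l := L%:R ^+ 2; have l0 : 0 <= l by rewrite sqr_ge0.
set dd := D ^+ 2; have d0 : 0 <= dd by rewrite sqr_ge0.
clearbody a u w l dd x.
pose c1 := C * (dd + w) + 2 * l * M.
have c10 : 0 <= c1 by rewrite addr_ge0 ?mulr_ge0 ?addr_ge0.
have e1 : u * (r * x * c1) <= u * c1.
  by rewrite ler_wpM2l // -[leRHS]mul1r ler_wpM2r.
have v0 := v2_ge0.
apply: (@le_trans _ _ (2 * a * (1 + v2) * M + u * (2 * (r * eps)) * (1 + v2) + u * c1)).
  have : 0 <= a * M * v2 by apply: mulr_ge0 => //; exact: mulr_ge0.
  by rewrite /c1 in e1 *; nra.
have e2 : u * c1 <= u * ((2 + dd + w + 2 * l) * (M + C)) * (1 + v2).
  rewrite -[leLHS]mulr1 ler_pM ?mulr_ge0 ?lerDl // ler_wpM2l // /c1.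
  have : 0 <= (2 + dd + w) * M by rewrite !mulr_ge0 ?addr_ge0.
  have : 0 <= (2 + 2 * l) * C by rewrite !mulr_ge0 ?addr_ge0 ?mulr_ge0.
  by nra.
have r_ge0 := ltW r0.
have re0 : 0 <= r * eps by rewrite mulr_ge0.
have t1 : 0 <= a * (1 + v2) * C by rewrite !mulr_ge0 ?addr_ge0.
have t2 : 0 <= a * (1 + v2) * (r * eps) by rewrite !mulr_ge0 ?addr_ge0.
have t3 : 0 <= u * (dd + w + 2 * l) * (1 + v2) * (r * eps).
  have s0 : 0 <= dd + w + 2 * l by rewrite !addr_ge0 ?mulr_ge0.
  by apply: mulr_ge0 => //; apply: mulr_ge0; [exact: mulr_ge0|exact: addr_ge0].
by nra.
Qed.

End smooth_test_function.

End normal_approximation.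

(** * Moments of the occurrence counts in a random word *)

Section draw.
Variable R : realType.
Implicit Types (cnt : nat -> nat) (acc a b : seq nat).

(** Probability of drawing the letters [a] in this order, without replacement,
    from a population of [N] letters with multiplicities [cnt] from which the
    letters [acc] are already removed. *)
Fixpoint draw cnt (N : nat) acc a : R :=
  if a is c :: a' then
    ((cnt c)%:R - (count_mem c acc)%:R) / (N%:R - (size acc)%:R) *
      draw cnt N (rcons acc c) a'
  else 1.

Lemma draw_cat cnt N acc a b :
  draw cnt N acc (a ++ b) = draw cnt N acc a * draw cnt N (acc ++ a) b.
Proof.
elim: a acc => [|c a IH] acc /=; first by rewrite mul1r cats0.
by rewrite IH cat_rcons mulrA.
Qed.

End draw.

Section occurrence_moments.
Variables (R : realType) (n : nat) (s : 'I_n.+1 -> nat).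
Local Notation N := n.+1.
Implicit Types (sigma : 'S_N) (us vs : seq 'I_N) (acc a b : seq nat) (t : tree).

Local Notation mean := (@mean R {perm 'I_N}).

Definition multiplicity (c : nat) : nat := (\sum_i (s i == c))%N.

Local Notation draw := (draw R multiplicity N).

Definition letters sigma us : seq nat := [seq s (sigma u) | u <- us].

(** By exchangeability all unread positions are equally likely to carry the letter
    [c], and together they carry all the copies of [c] that are left. *)
Lemma mean_next_letter us v acc c : uniq (rcons us v) -> size us = size acc ->
  mean (fun sigma => (letters sigma (rcons us v) == rcons acc c)%:R) =
  mean (fun sigma => (letters sigma us == acc)%:R) *
  (((multiplicity c)%:R - (count_mem c acc)%:R) / (N%:R - (size acc)%:R)).
Proof.
rewrite rcons_uniq => /andP[vus uus] sus.
have split_last v' sigma : (letters sigma (rcons us v') == rcons acc c)%:R =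
    (letters sigma us == acc)%:R * (s (sigma v') == c)%:R :> R.
  by rewrite /letters map_rcons eqseq_rcons -natrM mulnb.
(* a transposition carries [v] to any other position outside [us] *)
have sameP v' : v' \notin us ->
    mean (fun sigma => (letters sigma (rcons us v') == rcons acc c)%:R) =
    mean (fun sigma => (letters sigma (rcons us v) == rcons acc c)%:R).
  move=> v'us; rewrite -(mean_mull (tperm v v')); apply: eq_mean => sigma.
  congr (_ == _)%:R; rewrite /letters !map_rcons permM tpermR; congr rcons.
  apply/eq_in_map => u uus'; rewrite permM tpermD //.
    by apply: contraNneq vus => ->.
  by apply: contraNneq v'us => ->.
have outside (F : 'I_N -> R) :
    \sum_(v' | v' \notin us) F v' = \sum_v' F v' - \sum_(u <- us) F u.
  by rewrite (bigID (mem us) xpredT) /= -big_uniq // [X in X - _]addrC addrK.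
have Nus : \sum_(v' | v' \notin us) (1 : R) = N%:R - (size acc)%:R.
  rewrite outside sumr_const card_ord -sus; congr (_ - _).
  by rewrite big_const_seq count_predT iter_addr addr0.
have N0 : N%:R - (size acc)%:R != 0 :> R.
  rewrite -Nus sumr_const pnatr_eq0 -lt0n; apply/card_gt0P.
  by exists v.
apply: (mulIf N0); rewrite -[RHS]mulrA divfK //.
rewrite -[in LHS]Nus mulr_sumr.
under eq_bigr => v' v'us do rewrite mulr1 -(sameP v' v'us).
rewrite -mean_sum -meanZr; apply: eq_mean => sigma.
under eq_bigr do rewrite split_last.
rewrite -mulr_sumr; have [/eqP e|] := boolP (letters sigma us == acc); last by rewrite !mul0r.
congr (_ * _); rewrite outside; congr (_ - _).
  rewrite /multiplicity natr_sum [RHS](reindex_inj (@perm_inj _ sigma)) //.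
rewrite -e /letters count_map -sum1_count natr_sum [RHS]big_mkcond /=.
by apply: eq_bigr => u _; case: eqP.
Qed.

Lemma mean_letters us vs acc a :
    uniq (us ++ vs) -> size us = size acc -> size vs = size a ->
  mean (fun sigma => (letters sigma (us ++ vs) == acc ++ a)%:R) =
  mean (fun sigma => (letters sigma us == acc)%:R) * draw acc a.
Proof.
elim: vs us acc a => [|v vs IH] us acc [|c a] //= uusvs sus svs.
  by rewrite !cats0 mulr1.
rewrite -!cat_rcons in uusvs *.
have /andP[uusv _] : uniq (rcons us v) && true.
  by move: uusvs; rewrite cat_uniq => /and3P[->].
rewrite IH ?size_rcons ?sus //; last by case: svs.
by rewrite mean_next_letter // -mulrA.
Qed.

Lemma mean_letters0 us a : uniq us -> size us = size a ->
  mean (fun sigma => (letters sigma us == a)%:R) = draw [::] a.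
Proof.
move=> uus sus; have := @mean_letters [::] us [::] a uus erefl sus.
by rewrite /= => ->; rewrite (mean_cst (perms_gt0 n)) mul1r.
Qed.

Lemma prefix_word a k sigma : (size a <= N)%N ->
  prefix a (rot k (word s sigma)) =
  (letters sigma (take (size a) (rot k (enum 'I_N))) == a).
Proof. by move=> aN; rewrite prefixE /word -map_rot -map_take. Qed.

Lemma mean_rot (Psi : seq nat -> R) (k : 'I_N) :
  mean (fun sigma => Psi (rot k (word s sigma))) =
  mean (fun sigma => Psi (word s sigma)).
Proof.
rewrite -[RHS](mean_mull (rotation k)); apply: eq_mean => sigma.
by rewrite rot_word.
Qed.

Lemma mean_prefix a : (size a <= N)%N ->
  mean (fun sigma => (prefix a (word s sigma))%:R) = draw [::] a.
Proof.
move=> aN; rewrite -(@mean_letters0 (take (size a) (enum 'I_N))).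
- by apply: eq_mean => sigma; rewrite -[word s sigma]rot0 prefix_word // rot0.
- by rewrite take_uniq // enum_uniq.
- by rewrite size_takel // size_enum_ord.
Qed.

Lemma mean_occurrences t : (tree_size t <= N)%N ->
  mean (fun sigma => (occurrences t (word s sigma))%:R) = N%:R * draw [::] (code t).
Proof.
move=> tN; rewrite /occurrences.
under eq_mean => sigma do rewrite size_word natr_sum.
rewrite mean_sum; under eq_bigr => i _.
  rewrite (mean_rot (fun w => (prefix (code t) w)%:R)) mean_prefix ?size_code //.
  over.
by rewrite sumr_const card_ord mulr_natl.
Qed.

Lemma mean_prefix2 a b d : (size a <= d)%N -> (d + size b <= N)%N ->
  mean (fun sigma => (prefix a (word s sigma))%:R *
                     (prefix b (rot d (word s sigma)))%:R) = draw [::] (a ++ b).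
Proof.
move=> ad dbN; have aN : (size a <= N)%N by lia.
have bN : (size b <= N)%N by lia.
pose us := take (size a) (enum 'I_N); pose vs := take (size b) (drop d (enum 'I_N)).
have vsE : take (size b) (rot d (enum 'I_N)) = vs.
  by rewrite /rot takel_cat // size_drop size_enum_ord; lia.
have sus : size us = size a by rewrite size_takel // size_enum_ord.
have svs : size vs = size b by rewrite size_takel // size_drop size_enum_ord; lia.
rewrite -(@mean_letters0 (us ++ vs)).
- apply: eq_mean => sigma; rewrite -[X in prefix a X]rot0 !prefix_word // rot0 vsE.
  by rewrite /letters map_cat eqseq_cat ?size_map ?sus // -natrM mulnb.
- apply: (@subseq_uniq _ _ (enum 'I_N)); last exact: enum_uniq.
  rewrite -[X in subseq _ X](cat_take_drop d) cat_subseq //; last exact: take_subseq.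
  by rewrite /us -(take_takel _ ad) take_subseq.
- by rewrite !size_cat sus svs.
Qed.

(** Two windows that read words of trees are nested or disjoint, so that only
    fringe subtrees and draws from disjoint windows contribute. *)
Lemma mean_occurrences_mul t t' :
    (tree_size t + tree_size t' <= N)%N ->
  mean (fun sigma => (occurrences t (word s sigma))%:R *
                     (occurrences t' (word s sigma))%:R) =
  N%:R * (draw [::] (code t) * (count_mem t' (fringe t))%:R +
    draw [::] (code t') * ((count_mem t (fringe t'))%:R - (t == t')%:R) +
    (N%:R + 1 - (tree_size t)%:R - (tree_size t')%:R) *
      draw [::] (code t ++ code t')).
Proof.
set r := tree_size t; set r' := tree_size t' => rN.
have r0 : (0 < r)%N by rewrite /r -size_code code_gt0.
have r'0 : (0 < r')%N by rewrite /r' -size_code code_gt0.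
have tN : (size (code t) <= N)%N by rewrite size_code -/r; lia.
have t'N : (size (code t') <= N)%N by rewrite size_code -/r'; lia.
pose G u u' (d : nat) := mean (fun sigma => (prefix (code u) (word s sigma))%:R *
                     (prefix (code u') (rot d (word s sigma)))%:R).
have inside u u' d : (size (code u) <= N)%N -> (d < tree_size u)%N ->
    G u u' d = draw [::] (code u) * (nth u (fringe u) d == u')%:R.
  move=> uN du; rewrite /G -mean_prefix // -meanZr; apply: eq_mean => sigma.
  have [/prefixP[v ->]|] := boolP (prefix (code u) _); last by rewrite !mul0r.
  rewrite /rot drop_cat size_code du -catA prefix_code_nth //.
have Gsym d : (0 < d < N)%N -> G t t' d = G t' t (N - d)%N.
  move=> /andP[d0 dN]; pose e := Ordinal dN.
  rewrite /G -(mean_rot (fun w => (prefix (code t') w)%:R *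
    (prefix (code t) (rot (N - d) w))%:R) e) /=.
  apply: eq_mean => sigma; rewrite mulrC.
  congr (_ * (nat_of_bool (prefix _ _))%:R); rewrite -rotD ?subnK ?size_word ?(ltnW dN) //.
  by rewrite -[X in rot X](size_word s sigma) rot_size.
have sumG : mean (fun sigma => (occurrences t (word s sigma))%:R *
    (occurrences t' (word s sigma))%:R) = N%:R * \sum_(0 <= d < N) G t t' d.
  transitivity (mean (fun sigma => \sum_(i < N) \sum_(d < N)
      (prefix (code t) (rot i (word s sigma)))%:R *
      (prefix (code t') (rot d (rot i (word s sigma))))%:R)).
    apply: eq_mean => sigma; rewrite /occurrences size_word !natr_sum mulr_suml.
    apply: eq_bigr => i _; rewrite mulr_sumr [LHS](reindex_inj (addrI i)) /=.
    apply: eq_bigr => d _; congr (_ * (nat_of_bool (prefix _ _))%:R).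
    rewrite (rot_word s (i + d)) !rot_word; congr word; apply/permP => x.
    rewrite !permM !permE.
    by rewrite addrA.
  have NE : N%:R = \sum_(i < N) 1 :> R by rewrite sumr_const card_ord.
  rewrite mean_sum [in RHS]NE mulr_suml.
  apply: eq_bigr => i _; rewrite mul1r mean_sum big_mkord; apply: eq_bigr => d _.
  exact: (mean_rot (fun w => (prefix (code t) w)%:R * (prefix (code t') (rot d w))%:R)).
rewrite sumG; congr (_ * _).
(* the second window starts inside the first one, is disjoint from it, or,
   cyclically, contains the start of the first one *)
rewrite (big_cat_nat _ (n := r)) //=; last by lia.
rewrite [X in _ + X](big_cat_nat _ (n := (N - r').+1)) //=; [|lia|lia].
rewrite addrA addrAC; congr (_ + _ + _).
- under eq_big_nat => d /andP[_ dr] do rewrite inside //.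
  rewrite -mulr_sumr; congr (_ * _); rewrite -sum1_count natr_sum.
  rewrite [RHS](big_nth t) [RHS]big_mkcond; apply: eq_bigr => d _.
  by rewrite /=; case: (_ == t').
- rewrite (eq_big_nat _ _ (F2 := fun d => G t' t (N - d)%N)); last first.
    by move=> d /andP[dl dN]; apply: Gsym; lia.
  have -> : \sum_((N - r').+1 <= d < N) G t' t (N - d)%N = \sum_(1 <= e < r') G t' t e.
    rewrite -{1}[(N - r').+1]add0n big_addn.
    rewrite (_ : (N - (N - r').+1 = r'.-1)%N); last by lia.
    rewrite big_nat_rev [RHS]big_add1; apply: eq_big_nat => e he.
    by congr G; lia.
  under eq_big_nat => d /andP[_ dr] do rewrite inside //.
  rewrite -mulr_sumr; congr (_ * _); apply/esym/eqP; rewrite subr_eq; apply/eqP.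
  rewrite -sum1_count natr_sum (big_nth t') big_mkcond /= -/r' big_ltn //.
  rewrite addrC; congr (_ + _).
    by apply: eq_bigr => d _ /=; case: (_ == t).
  by rewrite [t == _]eq_sym; case: (t') => ss /=; case: eqP.
- under eq_big_nat => d /andP[rd dN].
    rewrite /G mean_prefix2 ?size_code -/r -/r'; [|lia|lia].
    over.
  rewrite sumr_const_nat -[LHS]mulr_natl; congr (_ * _).
  suff -> : N%:R = ((N - r').+1 - r)%:R + r%:R + r'%:R - 1 :> R by ring.
  by apply: (addIr 1); rewrite subrK -!natrD natr1; congr _%:R; lia.
Qed.

End occurrence_moments.

(** * The limiting variance *)

Lemma fsbig_setT_seq (R : Type) (idx : R) (op : Monoid.com_law idx)
    (T : choiceType) (r : seq T) (f : T -> R) :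
  uniq r -> (forall i, i \notin r -> f i = idx) ->
  \big[op/idx]_(i \in [set: T]) f i = \big[op/idx]_(i <- r) f i.
Proof.
move=> ur fidx; rewrite (@fsbigE _ _ _ _ _ r) //; last by move=> i _; exact: fidx.
by apply: eq_bigl => i; rewrite in_setT.
Qed.

Section small_trees.

Lemma finite_small_trees K : finite_set [set t | (tree_size t <= K)%N].
Proof.
(* words are padded to a common length, and the first component remembers the
   true length *)
pose decode (x : 'I_K.+1 * K.-tuple 'I_K.+1) : tree :=
  xget (Node [::]) [set t | code t = map val (take x.1 x.2)].
apply: (@sub_finite_set _ _ (decode @` setT)); last first.
  by apply: finite_image; exact: finite_finset.
move=> t /= tK.
have szw : size (map (@inord K) (code t) ++ nseq (K - tree_size t) ord0) == K.
  by rewrite size_cat size_map size_code size_nseq subnKC.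
exists (inord (tree_size t), Tuple szw) => //.
have tE : code t = map val (take (inord (tree_size t) : 'I_K.+1)
    (map (@inord K) (code t) ++ nseq (K - tree_size t) ord0)).
  rewrite inordK // take_cat size_map size_code ltnn subnn take0 cats0 -map_comp.
  rewrite -[LHS]map_id; apply/eq_in_map => c ct /=; rewrite inordK // ltnS.
  apply: (leq_trans _ tK); rewrite -size_code -sumn_code.
  by rewrite (leq_trans _ (leq_addr _ _)) // sumnE (big_rem c) //= leq_addr.
rewrite /decode /=; case: xgetP => [u _ /= uE|/(_ t)]; last by case.
by apply: code_inj; exact: (etrans uE (esym tE)).
Qed.

Definition small_trees K : seq tree := fset_set [set t | (tree_size t <= K)%N].

Lemma mem_small_trees K t : (t \in small_trees K) = (tree_size t <= K)%N.
Proof.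
rewrite /small_trees in_fset_set; last exact: finite_small_trees.
by apply/idP/idP; rewrite inE.
Qed.

Lemma small_trees_uniq K : uniq (small_trees K). Proof. exact: fset_uniq. Qed.

End small_trees.

Section weights.
Variable R : realType.
Implicit Types (p : nat -> R) (f g : tree -> R) (K : nat) (t : tree).

Definition word_weight p (a : seq nat) : R := \prod_(c <- a) p c.

Lemma pi_weightE p t : pi_weight p t = word_weight p (code t).
Proof.
rewrite /pi_weight (@fsbig_setT_seq _ _ _ _ (undup (code t))) ?undup_uniq //; last first.
  by move=> i; rewrite mem_undup -count_code => /count_memPn ->.
transitivity (\big[*%R/1]_(i <- undup (code t))
    iterop (count_mem i (code t)) *%R (p i) 1); last exact: big_undup_iterop_count.
apply: eq_bigr => i _.
by rewrite -count_code.
Qed.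

Lemma pi_expectation_small p K g :
    (forall t, (K < tree_size t)%N -> g t = 0) ->
  pi_expectation p g = \sum_(t <- small_trees K) g t * word_weight p (code t).
Proof.
move=> g0; rewrite /pi_expectation.
rewrite (@fsbig_setT_seq _ _ _ _ (small_trees K)) ?small_trees_uniq //.
  by apply: eq_bigr => t _; rewrite pi_weightE.
by move=> t; rewrite mem_small_trees -ltnNge => /g0 ->; rewrite mul0r.
Qed.

Lemma truncate_out K f t : (K < tree_size t)%N -> truncate K f t = 0.
Proof. by rewrite /truncate ltnNge => /negbTE ->. Qed.

Lemma truncate_in K f t : t \in small_trees K -> truncate K f t = f t.
Proof. by rewrite mem_small_trees /truncate => ->. Qed.

Lemma additive_truncateE K f t :
  additive_functional (truncate K f) t =
  \sum_(u <- small_trees K) f u * (count_mem u (fringe t))%:R.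
Proof.
rewrite /additive_functional; elim: (fringe t) => [|v s IH] /=.
  by rewrite big_nil big1 // => u _; rewrite mulr0.
rewrite big_cons IH; under [RHS]eq_bigr do rewrite natrD mulrDr.
rewrite big_split /=; congr (_ + _).
have [vK|vK] := leqP (tree_size v) K; last first.
  rewrite truncate_out // big_seq big1 // => u.
  by rewrite mem_small_trees; case: eqP vK => [->|]; rewrite ?mulr0 // ltnNge => /negbTE ->.
rewrite truncate_in ?mem_small_trees //.
rewrite (bigD1_seq v) ?small_trees_uniq ?mem_small_trees //= eqxx mulr1.
by rewrite big1 ?addr0 // => u /negbTE uv; rewrite eq_sym uv mulr0.
Qed.

(** First order effect, on the probability to draw [b], of the earlier removal
    of the letters [x] from a large population with letter frequencies [p]. *)
Fixpoint removal_drift p (x b : seq nat) : R :=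
  if b is c :: b' then
    ((size x)%:R * p c - (count_mem c x)%:R) * word_weight p b' +
      p c * removal_drift p x b'
  else 0.

Definition limit_covariance p t t' : R :=
  word_weight p (code t) * (count_mem t' (fringe t))%:R +
  word_weight p (code t') * ((count_mem t (fringe t'))%:R - (t == t')%:R) +
  (1 - (tree_size t)%:R - (tree_size t')%:R) *
    (word_weight p (code t) * word_weight p (code t')) +
  word_weight p (code t) * removal_drift p (code t) (code t').

Definition limit_variance p K f : R :=
  \sum_(t <- small_trees K) \sum_(t' <- small_trees K)
    f t * f t' * limit_covariance p t t'.

(** The factor [word_weight p x] allows to divide by letter frequencies: if [p c] is
    zero and [c] occurs in [x], then both sides vanish. *)
Lemma removal_driftE p x b M : (forall c, 0 <= p c) -> {in b, forall c, (c < M)%N} ->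
  word_weight p x * removal_drift p x b = word_weight p x * word_weight p b *
   ((size x)%:R * (size b)%:R -
    \sum_(0 <= i < M) if 0 < p i then
       (p i)^-1 * ((count_mem i x)%:R * (count_mem i b)%:R) else 0).
Proof.
move=> p0; elim: b => [|c b IH] bM /=.
  rewrite mulr0 big1 ?subr0 ?mulr0 // => i _; rewrite !mulr0.
  by case: ifP.
have /IH {}IH : {in b, forall c, (c < M)%N}.
  by move=> d db; apply: bM; rewrite inE db orbT.
rewrite mulrDr mulrCA [word_weight p x * (p c * _)]mulrCA IH.
rewrite [word_weight p (c :: b)]/word_weight big_cons -/(word_weight p b).
have cM : (c < M)%N by apply: bM; exact: mem_head.
have -> : \sum_(0 <= i < M) (if 0 < p i then
       (p i)^-1 * ((count_mem i x)%:R * ((c == i) + count_mem i b)%:R) else 0) =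
  (if 0 < p c then (p c)^-1 * (count_mem c x)%:R else 0) +
  \sum_(0 <= i < M) (if 0 < p i then
       (p i)^-1 * ((count_mem i x)%:R * (count_mem i b)%:R) else 0) :> R.
  have -> : (if 0 < p c then (p c)^-1 * (count_mem c x)%:R else 0) =
      \sum_(0 <= i < M) (if (0 < p i) && (i == c) then (p i)^-1 * (count_mem i x)%:R else 0) :> R.
    rewrite (bigD1_seq c) ?iota_uniq ?mem_index_iota //= eqxx andbT big1 ?addr0 // => i /negbTE ->.
    by rewrite andbF.
  rewrite -big_split /=; apply: eq_bigr => i _; rewrite eq_sym.
  by case: ifP => _; case: eqP => _ /=; rewrite ?addr0 ?add0r // natrD; ring.
set S := \sum_(_ <= _ < _) _.
have [pc|pc] := ltrP 0 (p c); first by field; rewrite gt_eqF.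
have {}pc : p c = 0 by apply/eqP; rewrite eq_le pc p0.
rewrite pc !(mul0r, mulr0, add0r, addr0, sub0r).
have [cx|/count_memPn ->] := boolP (c \in x); last by rewrite oppr0 !(mulr0, mul0r).
have -> : word_weight p x = 0.
  by apply/eqP; rewrite prodf_seq_eq0; apply/hasP; exists c => //=; rewrite pc.
by rewrite !mul0r ?mulr0.
Qed.

(** By [removal_driftE], the terms of [limit_covariance] in the sizes combine to
    the product of [tree_size t - 1] and [tree_size t' - 1], and the remaining sum
    gives the squares weighted by the inverses of the frequencies. *)
Lemma gamma_varianceE p K f : (forall i, 0 <= p i) ->
  gamma_variance p (truncate K f) = limit_variance p K f.
Proof.
move=> p0; rewrite /gamma_variance.
have out h : forall t, (K < tree_size t)%N -> truncate K f t * h t = 0.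
  by move=> t /truncate_out ->; rewrite mul0r.
have E1 h : pi_expectation p (fun t => truncate K f t * h t) =
    \sum_(t <- small_trees K) f t * word_weight p (code t) * h t.
  rewrite (@pi_expectation_small _ K) //; last exact: out.
  rewrite [LHS]big_seq [RHS]big_seq; apply: eq_bigr => t tK.
  by rewrite truncate_in // mulrAC.
have lettersK t : t \in small_trees K -> {in code t, forall c, (c < K)%N}.
  rewrite mem_small_trees => tK c ct.
  apply: (leq_trans _ tK); rewrite -size_code -sumn_code addn1 ltnS.
  by rewrite sumnE (big_rem c) //= leq_addr.
rewrite (@fsbig_setT_seq _ _ _ _ (index_iota 0 K)) ?iota_uniq //; last first.
  move=> i; rewrite mem_index_iota /= -leqNgt => Ki.
  case: ifP => // _; rewrite E1 big_seq big1 ?expr0n ?mulr0 // => t tK.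
  rewrite -count_code (_ : count_mem i (code t) = 0%N) ?mulr0 //.
  by apply/count_memPn; apply/negP => /(lettersK _ tK); rewrite ltnNge Ki.
under eq_bigr do rewrite E1.
rewrite -[X in _ - X + _ - _](_ : pi_expectation p (fun t => truncate K f t * truncate K f t) = _); last first.
  by congr pi_expectation; apply/funext => t; rewrite expr2.
rewrite !E1.
have -> : \sum_(t <- small_trees K) f t * word_weight p (code t) * truncate K f t =
   \sum_(t <- small_trees K) \sum_(t' <- small_trees K)
      f t * f t' * (word_weight p (code t') * (t == t')%:R).
  rewrite [LHS]big_seq [RHS]big_seq; apply: eq_bigr => t tK; rewrite truncate_in //.
  rewrite (bigD1_seq t) ?small_trees_uniq //= eqxx mulr1 big1 ?addr0.
    by rewrite mulrAC.
  by move=> t' /negbTE tt'; rewrite eq_sym tt' !mulr0.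
have -> : \sum_(t <- small_trees K) f t * word_weight p (code t) *
      additive_functional (truncate K f) t =
   \sum_(t <- small_trees K) \sum_(t' <- small_trees K)
      f t * f t' * (word_weight p (code t) * (count_mem t' (fringe t))%:R).
  apply: eq_bigr => t _; rewrite additive_truncateE mulr_sumr.
  by apply: eq_bigr => t' _; ring.
have sqrE (h : tree -> R) : (\sum_(t <- small_trees K) f t * word_weight p (code t) * h t) ^+ 2 =
  \sum_(t <- small_trees K) \sum_(t' <- small_trees K)
      f t * f t' * (word_weight p (code t) * word_weight p (code t') * (h t * h t')).
  rewrite expr2 mulr_suml; apply: eq_bigr => t _; rewrite mulr_sumr.
  by apply: eq_bigr => t' _; ring.
rewrite (sqrE (fun t => (tree_size t)%:R - 1)).
have -> : \sum_(0 <= i < K) (if 0 < p i then (p i)^-1 *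
    (\sum_(t <- small_trees K) f t * word_weight p (code t) * (n_children t i)%:R) ^+ 2 else 0) =
  \sum_(t <- small_trees K) \sum_(t' <- small_trees K)
      f t * f t' * (word_weight p (code t) * word_weight p (code t') *
        \sum_(0 <= i < K) (if 0 < p i then
         (p i)^-1 * ((n_children t i)%:R * (n_children t' i)%:R) else 0)).
  under [RHS]eq_bigr do under eq_bigr do rewrite !mulr_sumr.
  under [RHS]eq_bigr do rewrite exchange_big /=.
  rewrite [RHS]exchange_big /=; apply: eq_bigr => i _.
  case: ifP => _; last by rewrite big1 // => t _; rewrite big1 // => t' _; rewrite !mulr0.
  rewrite sqrE mulr_sumr; apply: eq_bigr => t _; rewrite mulr_sumr.
  by apply: eq_bigr => t' _; ring.
rewrite mulr_natl mulr2n {2}exchange_big /=.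
rewrite /limit_variance -big_split /= -sumrB -big_split /= -sumrB.
rewrite [LHS]big_seq [RHS]big_seq; apply: eq_bigr => t tK.
rewrite -big_split /= -sumrB -big_split /= -sumrB.
rewrite [LHS]big_seq [RHS]big_seq; apply: eq_bigr => t' t'K.
rewrite /limit_covariance (@removal_driftE _ _ _ K) //; last exact: lettersK.
rewrite !size_code.
under [in RHS]eq_bigr do rewrite !count_code.
by ring.
Qed.

End weights.

Section limits.
Variables (R : realType) (cnt : nat -> nat -> nat) (N : nat -> nat) (p : nat -> R).
Hypothesis N_gt0 : forall k, (0 < N k)%N.
Hypothesis N_infty : N k @[k --> \oo] --> \oo.
Hypothesis frequencies : forall i, (cnt k i)%:R / (N k)%:R @[k --> \oo] --> p i.

Lemma cvg_size : ((N k)%:R : R) @[k --> \oo] --> +oo.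
Proof. by apply: (cvg_comp _ _ N_infty); exact: cvgr_idn. Qed.

Lemma cvg_size_inv : ((N k)%:R^-1 : R) @[k --> \oo] --> (0 : R).
Proof.
apply/cvgrPdist_lt => e e0.
have /cvgryPgt/(_ e^-1) := cvg_size.
apply: filterS => k eN; rewrite sub0r normrN ger0_norm ?invr_ge0 //.
by rewrite invf_plt ?posrE ?ltr0n.
Qed.

Lemma cvg_shifted_size j : (1 - j%:R * (N k)%:R^-1 : R) @[k --> \oo] --> (1 : R).
Proof.
suff: (1 - j%:R * (N k)%:R^-1 : R) @[k --> \oo] --> (1 - j%:R * 0 : R).
  by rewrite mulr0 subr0.
by apply: cvgB; [exact: cvg_cst|apply: cvgMr; exact: cvg_size_inv].
Qed.

Lemma cvg_draw_factor acc c :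
  (((cnt k c)%:R - (count_mem c acc)%:R) / ((N k)%:R - (size acc)%:R) : R)
    @[k --> \oo] --> p c.
Proof.
have -> : p c = (p c - (count_mem c acc)%:R * 0) / 1 by rewrite mulr0 subr0 divr1.
apply: (@cvg_trans _ (((cnt k c)%:R / (N k)%:R - (count_mem c acc)%:R * (N k)%:R^-1)
    / (1 - (size acc)%:R * (N k)%:R^-1) @[k --> \oo])).
  apply: near_eq_cvg; near=> k.
  have N0 : (N k)%:R != 0 :> R by rewrite pnatr_eq0 -lt0n.
  have N1 : (N k)%:R - (size acc)%:R != 0 :> R.
    rewrite subr_eq0 gt_eqF //; near: k; move/cvgryPgt : cvg_size; exact.
  by field; rewrite N0 N1.
apply: cvgM; last by apply: cvgV; [exact: oner_neq0|exact: cvg_shifted_size].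
by apply: cvgB => //; apply: cvgMr; exact: cvg_size_inv.
Unshelve. all: by end_near. Qed.

Lemma cvg_draw acc a :
  draw R (cnt k) (N k) acc a @[k --> \oo] --> word_weight p a.
Proof.
elim: a acc => [|c a IH] acc /=; first by rewrite /word_weight big_nil; exact: cvg_cst.
rewrite /word_weight big_cons; apply: cvgM; last exact: IH.
exact: cvg_draw_factor.
Qed.

(** The product of the drawing probabilities is differentiated factor by factor. The
    letters [acc] are drawn in both situations, and hence disappear in the
    limit. *)
Lemma cvg_removal_drift x acc b :
  (N k)%:R * (draw R (cnt k) (N k) (x ++ acc) b - draw R (cnt k) (N k) acc b)
    @[k --> \oo] --> removal_drift p x b.
Proof.
elim: b acc => [|c b IH] acc /=.
  by under eq_fun do rewrite subrr mulr0; exact: cvg_cst.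
pose alpha acc' k : R := ((cnt k c)%:R - (count_mem c acc')%:R) / ((N k)%:R - (size acc')%:R).
have step : (N k)%:R * (alpha (x ++ acc) k - alpha acc k) @[k --> \oo] -->
    (size x)%:R * p c - (count_mem c x)%:R.
  have -> : (size x)%:R * p c - (count_mem c x)%:R =
    (p c - (count_mem c acc)%:R * 0) / 1 * (size x)%:R / 1 - (count_mem c x)%:R / 1.
    by rewrite mulr0 subr0 !divr1 mulrC.
  apply: (@cvg_trans _ ((((cnt k c)%:R / (N k)%:R - (count_mem c acc)%:R * (N k)%:R^-1)
    / (1 - (size acc)%:R * (N k)%:R^-1) * (size x)%:R /
     (1 - (size (x ++ acc))%:R * (N k)%:R^-1) - (count_mem c x)%:R /
      (1 - (size (x ++ acc))%:R * (N k)%:R^-1)) @[k --> \oo])).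
    apply: near_eq_cvg; near=> k.
    have N0 : (N k)%:R != 0 :> R by rewrite pnatr_eq0 -lt0n.
    have N1 : (N k)%:R - (size acc)%:R != 0 :> R.
      rewrite subr_eq0 gt_eqF //; near: k; move/cvgryPgt : cvg_size; exact.
    have N2 : (N k)%:R - ((size x)%:R + (size acc)%:R) != 0 :> R.
      rewrite -natrD subr_eq0 gt_eqF //; near: k; move/cvgryPgt : cvg_size; exact.
    rewrite /alpha count_cat size_cat !natrD.
    by field; rewrite N0 N1 N2.
  have inv1 j : ((1 - j%:R * (N k)%:R^-1)^-1 : R) @[k --> \oo] --> (1^-1 : R).
    by apply: cvgV; [exact: oner_neq0|exact: cvg_shifted_size].
  apply: cvgB; last by apply: cvgMr; exact: inv1.
  apply: cvgM; last exact: inv1; apply: cvgMl; apply: cvgM; last exact: inv1.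
  by apply: cvgB => //; apply: cvgMr; exact: cvg_size_inv.
apply: (@cvg_trans _ (((N k)%:R * (alpha (x ++ acc) k - alpha acc k) *
    draw R (cnt k) (N k) (rcons (x ++ acc) c) b + alpha acc k *
    ((N k)%:R * (draw R (cnt k) (N k) (x ++ rcons acc c) b -
                 draw R (cnt k) (N k) (rcons acc c) b))) @[k --> \oo])).
  apply: near_eq_cvg; near=> k; rewrite -rcons_cat /alpha; ring.
apply: cvgD; first by apply: cvgM; [exact: step|exact: cvg_draw].
by apply: cvgM; [exact: cvg_draw_factor|exact: IH].
Unshelve. all: by end_near. Qed.

Lemma limit_covariance_cvg t t' :
  (draw R (cnt k) (N k) [::] (code t) * (count_mem t' (fringe t))%:R +
   draw R (cnt k) (N k) [::] (code t') * ((count_mem t (fringe t'))%:R - (t == t')%:R) +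
   ((N k)%:R + 1 - (tree_size t)%:R - (tree_size t')%:R) *
     draw R (cnt k) (N k) [::] (code t ++ code t') -
   (N k)%:R * (draw R (cnt k) (N k) [::] (code t) * draw R (cnt k) (N k) [::] (code t')))
    @[k --> \oo] --> limit_covariance p t t'.
Proof.
apply: (@cvg_trans _ ((draw R (cnt k) (N k) [::] (code t) * (count_mem t' (fringe t))%:R +
   draw R (cnt k) (N k) [::] (code t') * ((count_mem t (fringe t'))%:R - (t == t')%:R) +
   (1 - (tree_size t)%:R - (tree_size t')%:R) *
     (draw R (cnt k) (N k) [::] (code t) * draw R (cnt k) (N k) (code t) (code t')) +
   draw R (cnt k) (N k) [::] (code t) *
    ((N k)%:R * (draw R (cnt k) (N k) (code t ++ [::]) (code t') -
                 draw R (cnt k) (N k) [::] (code t')))) @[k --> \oo])).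
  by apply: near_eq_cvg; near=> k; rewrite draw_cat cats0 /=; ring.
apply: cvgD; last by apply: cvgM; [exact: cvg_draw|exact: cvg_removal_drift].
apply: cvgD; last by apply: cvgMr; apply: cvgM; exact: cvg_draw.
by apply: cvgD; apply: cvgMl; exact: cvg_draw.
Unshelve. all: by end_near. Qed.

End limits.

(** * Stein's equation for a centered normal law *)

Section normal_tail.
Variables (R : realType) (s : R).
Hypothesis s0 : s != 0.
Local Notation mu := (@lebesgue_measure R).
Local Notation phi := (normal_pdf 0 s).
Implicit Types x y : R.

Let s2_gt0 : 0 < s ^+ 2. Proof. by rewrite exprn_even_gt0. Qed.

Lemma normal_pdf_gt0 x : 0 < phi x.
Proof. by rewrite normal_pdfE // mulr_gt0 ?normal_peak_gt0 ?expR_gt0. Qed.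

Lemma normal_pdfN x : phi (- x) = phi x.
Proof. by rewrite !normal_pdfE // /normal_fun !subr0 sqrrN. Qed.

Lemma normal_pdf_le x y : 0 <= x -> x <= y -> phi y <= phi x.
Proof.
move=> x0 xy; rewrite !normal_pdfE // ler_wpM2l ?normal_peak_ge0 // ler_expR.
rewrite !subr0; apply: ler_wpM2r; first by rewrite invr_ge0 mulrn_wge0 // ltW.
by rewrite lerN2 ler_pXn2r // nnegrE (le_trans x0).
Qed.

Lemma is_derive_normal_pdf x : is_derive x 1 (phi : R -> R) (- (x / s ^+ 2) * phi x).
Proof.
have d1 : is_derive x 1 (fun y : R => - y ^+ 2 / (s ^+ 2 *+ 2)) (- (x / s ^+ 2)).
  rewrite (_ : (fun y : R => _) = (- (s ^+ 2 *+ 2)^-1) \*: (@id R ^+ 2)); last first.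
    by apply/funext => y /=; rewrite mulNr -mulrN mulrC.
  by apply: is_derive_eq; rewrite /GRing.scale /= expr1; field; exact: s0.
have -> : phi = normal_peak s \*: (expR \o (fun y : R => - y ^+ 2 / (s ^+ 2 *+ 2))).
  by apply/funext => y; rewrite normal_pdfE //= /normal_fun subr0.
have d2 := is_derive1_comp (is_derive_expR _) d1.
have d3 := is_deriveZ (normal_peak s) d2.
apply: (is_derive_eq d3); rewrite /GRing.scale /= /GRing.scale /=; ring.
Qed.

Lemma cvg_normal_pdf : phi x @[x --> +oo] --> (0 : R).
Proof.
have -> : phi = fun x => normal_peak s * expR (- (x ^+ 2 * (s ^+ 2 *+ 2)^-1)).
  by apply/funext => y; rewrite normal_pdfE //= /normal_fun subr0 mulNr.
rewrite -[X in _ --> X](mulr0 (normal_peak s)); apply: cvgMr.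
apply: (cvg_comp (fun x => x ^+ 2 * (s ^+ 2 *+ 2)^-1) (fun x => expR (- x))); last exact: cvgr_expR.
by apply: gt0_cvgMly; [rewrite invr_gt0 mulrn_wgt0|exact: cvgr_expr2].
Qed.

Lemma integrable_normal_pdfS (D : set R) : measurable D -> mu.-integrable D (EFin \o phi).
Proof.
move=> mD; apply: (@integrableS _ _ _ _ setT) => //.
exact: integrable_normal_pdf.
Qed.

Definition normal_tail x := \int[mu]_(y in `[x, +oo[) phi y.

Lemma normal_tail_le1 x : normal_tail x <= 1.
Proof.
rewrite /normal_tail /Rintegral -lee_fin fineK; last first.
  exact: integrable_fin_num (integrable_normal_pdfS _).
rewrite -(integral_normal_pdf 0 s); apply: ge0_subset_integral => //.
  by apply/measurable_EFinP; exact: measurable_normal_pdf.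
by move=> y _; rewrite lee_fin normal_pdf_ge0.
Qed.

(** Mills' bound: [y * phi y] has the explicit primitive [- s ^+ 2 * phi y]. *)
Lemma normal_tail_bound x : 0 < x -> x * normal_tail x <= s ^+ 2 * phi x.
Proof.
move=> x0.
have cphi : continuous (phi : R -> R) by exact: continuous_normal_pdf.
have cF : continuous (fun y => - s ^+ 2 * phi y : R).
  by move=> y; apply: cvgMr; exact: cphi.
have dF y : is_derive y 1 (fun y => - s ^+ 2 * phi y : R) (y * phi y).
  have := @is_deriveZ _ _ _ (phi : R -> R) (- s ^+ 2) y 1 _ (is_derive_normal_pdf y).
  move=> h; apply: (is_derive_eq h); rewrite /GRing.scale /=; field; exact: s0.
have FTC : (\int[mu]_(y in `[x, +oo[) (y * phi y)%:E = (s ^+ 2 * phi x)%:E)%E.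
  rewrite (@ge0_continuous_FTC2y _ _ (fun y => - s ^+ 2 * phi y) x 0).
  - by rewrite sub0e -EFinN mulNr opprK.
  - by move=> y xy; rewrite mulr_ge0 ?normal_pdf_ge0 // (le_trans (ltW x0)).
  - by apply: continuous_subspaceT => y; apply: cvgM; [exact: cvg_id|exact: cphi].
  - by rewrite -[X in _ --> X](mulr0 (- s ^+ 2)); apply: cvgMr; exact: cvg_normal_pdf.
  - by move=> y _; case: (dF y).
  - by apply: cvg_at_right_filter; exact: cF.
  - by move=> y _; rewrite derive1E; case: (dF y).
have iF : mu.-integrable `[x, +oo[ (EFin \o (fun y => y * phi y)).
  apply/integrableP; split.
    apply/measurable_EFinP/measurable_funTS/measurable_funM => //.
    exact: measurable_normal_pdf.
  rewrite [X in (X < _)%E](_ : _ = (s ^+ 2 * phi x)%:E) ?ltry // -FTC.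
  apply: eq_integral => y.
  rewrite inE /= in_itv /= andbT => xy.
  by rewrite /= ger0_norm // mulr_ge0 ?normal_pdf_ge0 // (le_trans (ltW x0)).
have -> : s ^+ 2 * phi x = \int[mu]_(y in `[x, +oo[) (y * phi y) by rewrite /Rintegral FTC.
rewrite /normal_tail -RintegralZl //; last exact: integrable_normal_pdfS.
apply: le_Rintegral => //.
  by apply: (@integrableZl _ _ _ mu _ _ _ (EFin \o phi)) => //; exact: integrable_normal_pdfS.
move=> y /=; rewrite in_itv /= andbT => xy.
by rewrite ler_wpM2r // normal_pdf_ge0.
Qed.

Lemma integral_normal_prob (f : R -> R) (M : R) : measurable_fun setT f ->
    (forall x, `|f x| <= M) ->
  (\int[normal_prob 0 s]_x (f x)%:E = \int[mu]_x (f x * phi x)%:E)%E.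
Proof.
move=> mf fM.
have intf : (normal_prob 0 s).-integrable setT (EFin \o f).
  apply/integrableP; split; first exact/measurable_EFinP.
  apply: (@le_lt_trans _ _ (\int[normal_prob 0 s]_x (cst M%:E x))%E).
    apply: ge0_le_integral => //=.
    - by apply/measurable_EFinP; exact: measurableT_comp.
    - by move=> x _; rewrite lee_fin.
  rewrite integral_cst //= (_ : normal_prob 0 s _ = 1%E) ?mule1 ?ltry //.
  exact: integral_normal_pdf.
rewrite -(Radon_Nikodym_change_of_variables (normal_prob_dominates 0 s)) //=.
under [RHS]eq_integral do rewrite EFinM.
apply: ae_eq_integral => //.
- apply: emeasurable_funM => //; first exact/measurable_EFinP.
  apply: (measurable_int mu); apply: Radon_Nikodym_integrable.
  exact: normal_prob_dominates.
- apply: emeasurable_funM => //; first exact/measurable_EFinP.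
  by apply/measurable_EFinP; exact: measurable_normal_pdf.
- apply: ae_eqe_mul2l => /=.
  rewrite Radon_NikodymE //=; first exact: normal_prob_dominates.
  move=> dom; case: cid => /= g [g1 g2 g3].
  apply: integral_ae_eq => //=.
  + by apply/measurable_EFinP; exact: measurable_normal_pdf.
  + by move=> E _ mE; rewrite -g3.
Qed.

End normal_tail.

Section stein_equation.
Variables (R : realType) (s : R) (h : R -> R) (M : R).
Hypothesis s0 : s != 0.
Hypothesis ch : continuous h.
Hypothesis hM : forall x, `|h x| <= M.
Local Notation mu := (@lebesgue_measure R).
Local Notation phi := (normal_pdf 0 s).

Let s2_gt0 : 0 < s ^+ 2. Proof. by rewrite exprn_even_gt0. Qed.

Definition normal_mean : R := \int[mu]_x (h x * phi x).

Let mh : measurable_fun setT h. Proof. exact: continuous_measurable_fun. Qed.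

Let int_bounded (k : R -> R) (M' : R) (D : set R) : measurable D -> measurable_fun setT k ->
  (forall x, `|k x| <= M') -> mu.-integrable D (EFin \o (fun x => k x * phi x)).
Proof.
move=> mD mk kM; apply: (@integrableS _ _ _ _ setT) => //.
apply: (@le_integrable _ _ R mu setT measurableT _ (fun x => (M' * phi x)%:E)) => //.
- by apply/measurable_EFinP/measurable_funM => //; exact: measurable_normal_pdf.
- move=> x _; rewrite lee_fin !normrM ler_wpM2r //.
  by rewrite (le_trans (kM x)) // ler_norm.
- by apply: (@integrableZl _ _ _ mu _ _ M' (EFin \o phi)) => //; exact: integrable_normal_pdf.
Qed.

Lemma integral_normal_mean :
  (\int[normal_prob 0 s]_x (h x)%:E = normal_mean%:E)%E.
Proof.
rewrite (integral_normal_prob s mh hM) /normal_mean /Rintegral fineK //.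
exact: integrable_fin_num (@int_bounded h M setT _ _ _).
Qed.

Let c := normal_mean.

Let c_le : `|c| <= M.
Proof.
rewrite /c /normal_mean; apply: (le_trans (le_normr_Rintegral _ _)) => //.
  exact: (@int_bounded h M).
have intphi : mu.-integrable setT (EFin \o phi) by exact: integrable_normal_pdf.
have -> : M = \int[mu]_x (M * phi x).
  by rewrite RintegralZl // /Rintegral integral_normal_pdf mulr1.
apply: le_Rintegral => //.
- rewrite (_ : EFin \o _ = abse \o (EFin \o (fun x => h x * phi x))) //.
  apply: integrable_abse; exact: (@int_bounded h M).
- exact: (@integrableZl _ _ _ mu _ _ M (EFin \o phi)).
- by move=> x _; rewrite normrM (ger0_norm (normal_pdf_ge0 _ _ _)) ler_wpM2r ?normal_pdf_ge0.
Qed.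

Let psi x := (h x - c) * phi x.

Let hcM x : `|h x - c| <= 2 * M.
Proof. by rewrite (le_trans (ler_normB _ _)) // mulr_natl mulr2n lerD. Qed.

Let int_psi D : measurable D -> mu.-integrable D (EFin \o psi).
Proof. by move=> mD; apply: (@int_bounded _ (2 * M)) => //; exact: measurable_funB. Qed.

Let integral_psi : \int[mu]_x psi x = 0.
Proof.
have intphi : mu.-integrable setT (EFin \o phi) by exact: integrable_normal_pdf.
transitivity (\int[mu]_x (h x * phi x - c * phi x)).
  by apply: eq_Rintegral => x _; rewrite /psi mulrBl.
rewrite RintegralB //; last 2 first.
- exact: (@int_bounded h M).
- exact: (@integrableZl _ _ _ mu _ _ c (EFin \o phi)).
by rewrite RintegralZl // [X in _ - _ * X]/Rintegral integral_normal_pdf mulr1 subrr.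
Qed.

Let abs_psi_le D : measurable D ->
  `|\int[mu]_(x in D) psi x| <= 2 * M * \int[mu]_(x in D) phi x.
Proof.
move=> mD; apply: (le_trans (le_normr_Rintegral _ _)) => //; first exact: int_psi.
have intphi : mu.-integrable D (EFin \o phi) by exact: integrable_normal_pdfS.
rewrite -RintegralZl //; apply: le_Rintegral => //.
- rewrite (_ : EFin \o _ = abse \o (EFin \o psi)) //.
  by apply: integrable_abse; exact: int_psi.
- exact: (@integrableZl _ _ _ mu _ _ (2 * M) (EFin \o phi)).
- by move=> x _; rewrite normrM (ger0_norm (normal_pdf_ge0 _ _ _)) ler_wpM2r ?normal_pdf_ge0.
Qed.

Let G x := \int[mu]_(y in `]-oo, x]) psi y.

Let G_le x : `|G x| <= 2 * M * normal_tail s `|x|.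
Proof.
have M0 : 0 <= 2 * M by rewrite mulr_ge0 // (le_trans (normr_ge0 _) (hM 0)).
have [x0|x0] := lerP 0 x.
  have -> : G x = - \int[mu]_(y in `]x, +oo[) psi y.
    rewrite -(@Rintegral_itvB _ _ -oo%O) //; last exact: int_psi.
    by rewrite set_itvNyy integral_psi sub0r opprK.
  rewrite normrN (le_trans (abs_psi_le _)) // ler_wpM2l //.
  rewrite /normal_tail ger0_norm // Rintegral_itv_obnd_cbnd //.
  exact: integrable_normal_pdfS.
rewrite (le_trans (abs_psi_le _)) // ler_wpM2l // /normal_tail /Rintegral.
rewrite ltr0_norm // -{1}[x]opprK (@ge0_integration_by_substitutionNy _ phi (- x)).
- by rewrite le_eqVlt; apply/orP; left; apply/eqP; congr fine;
    apply: eq_integral => y _ /=; rewrite normal_pdfN.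
- by apply: continuous_subspaceT; exact: continuous_normal_pdf.
- by move=> y _; exact: normal_pdf_ge0.
Qed.

Let f x := G x / (s ^+ 2 * phi x).
Let f' x := (x * f x + h x - c) / s ^+ 2.

Let is_derive_G (x : R) : is_derive x 1 G (psi x).
Proof.
have cpsi : {for x, continuous psi}.
  apply: cvgM; last exact: continuous_normal_pdf.
  by apply: cvgB; [exact: ch|exact: cvg_cst].
have /= [] := @continuous_FTC1 R psi -oo%O x (x + 1) _ _ _ cpsi.
- by rewrite ltrDl.
- exact: int_psi.
- exact: ltNyr.
- by move=> dG GE; apply: DeriveDef => //; rewrite -derive1E GE.
Qed.

Let is_derive_f (x : R) : is_derive x 1 f (f' x).
Proof.
have phi0 : phi x != 0 by rewrite gt_eqF ?normal_pdf_gt0.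
have d1 : is_derive x 1 (fun y => s ^+ 2 * phi y : R) (- x * phi x).
  have h1 := @is_deriveZ _ _ _ (phi : R -> R) (s ^+ 2) x 1 _ (is_derive_normal_pdf s0 x).
  by apply: (is_derive_eq h1); rewrite /GRing.scale /=; field; exact: s0.
have d2 := @is_deriveV _ (fun y => s ^+ 2 * phi y : R) x _ 1 (mulf_neq0 (lt0r_neq0 s2_gt0) phi0) d1.
have d3 := is_deriveM (is_derive_G x) d2.
apply: (is_derive_eq d3); rewrite /f' /f /psi /GRing.scale /=.
by field; rewrite s0 phi0.
Qed.

Let xf_le x : `|x * f x| <= 2 * M.
Proof.
have [->|x0] := eqVneq x 0; first by rewrite mul0r normr0 (le_trans _ (hcM 0)).
have pp := normal_pdf_gt0 s0 x.
have pp' := normal_pdf_gt0 s0 `|x|.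
have phin : phi `|x| = phi x by case: ler0P => // _; rewrite normal_pdfN.
have -> : `|x * f x| = `|x| * `|G x| / (s ^+ 2 * phi x).
  by rewrite /f normrM normrM normfV (gtr0_norm (mulr_gt0 s2_gt0 pp)) mulrA.
rewrite ler_pdivrMr; last exact: mulr_gt0.
apply: (@le_trans _ _ (`|x| * (2 * M * normal_tail s `|x|))).
  by rewrite ler_wpM2l // G_le.
rewrite mulrCA ler_wpM2l //; first by rewrite (le_trans _ (hcM 0)).
by rewrite -phin; apply: normal_tail_bound; rewrite ?normr_gt0.
Qed.

Let M1 := 2 * M / (s ^+ 2 * phi 1).

Let f_le x : `|f x| <= 2 * M + M1.
Proof.
have M0 : 0 <= 2 * M by rewrite (le_trans _ (hcM 0)).
have pp := normal_pdf_gt0 s0 x; have p1 := normal_pdf_gt0 s0 1.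
have M10 : 0 <= M1 by rewrite divr_ge0 // ltW // mulr_gt0.
have [x1|x1] := lerP 1 `|x|.
  rewrite -[leLHS]mul1r; apply: (@le_trans _ _ (`|x| * `|f x|)).
    by rewrite ler_wpM2r.
  by rewrite -normrM (le_trans (xf_le x)) // lerDl.
apply: (@le_trans _ _ M1); last by rewrite lerDr.
have phin : phi `|x| = phi x by case: ler0P => // _; rewrite normal_pdfN.
rewrite /f /M1 normrM normfV (gtr0_norm (mulr_gt0 s2_gt0 pp)).
apply: ler_pM => //; first by rewrite invr_ge0 ltW // mulr_gt0.
  rewrite (le_trans (G_le x)) // -[leRHS]mulr1 ler_wpM2l // normal_tail_le1 //.
have le_phi : s ^+ 2 * phi 1 <= s ^+ 2 * phi x.
  by rewrite -phin; apply: ler_wpM2l; [exact: ltW|apply: normal_pdf_le => //; exact: ltW].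
by rewrite lef_pV2 ?posrE // mulr_gt0.
Qed.

(** The solution is the integral of [h - normal_mean] against the density up to
    [x], divided by [s ^+ 2] times the density. As the integral over the whole line
    vanishes, it is bounded by a tail of the density on both sides, and Mills'
    bound controls both [f x] and [x * f x]. *)
Lemma stein_equation : exists (f f' : R -> R) (Mf : R),
  [/\ forall x, `|f x| <= Mf, forall x, `|f' x| <= Mf,
      continuous f', forall x : R, is_derive x 1 f (f' x) &
      forall x, s ^+ 2 * f' x - x * f x = h x - normal_mean].
Proof.
have M0 : 0 <= 2 * M by rewrite (le_trans _ (hcM 0)).
have M10 : 0 <= M1.
  by rewrite divr_ge0 // ltW // mulr_gt0 // normal_pdf_gt0.
exists f, f', (2 * M + M1 + 4 * M / s ^+ 2); split.
- move=> x; rewrite (le_trans (f_le x)) // lerDl divr_ge0 ?(ltW s2_gt0) //.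
  have -> : 4 * M = 2 * (2 * M) by ring.
  exact: mulr_ge0.

- move=> x; apply: (@le_trans _ _ (4 * M / s ^+ 2)); last by rewrite lerDr addr_ge0.
  rewrite /f' normrM normfV (gtr0_norm s2_gt0) ler_wpM2r ?invr_ge0 ?(ltW s2_gt0) //.
  rewrite -addrA (le_trans (ler_normD _ _)) // (le_trans (lerD (xf_le x) (hcM x))) //.
  by rewrite -mulrDl -natrD.
- move=> x; apply: cvgM; last exact: cvg_cst.
  apply: cvgB; last exact: cvg_cst.
  apply: cvgD; last exact: ch.
  apply: cvgM; first exact: cvg_id.
  have [df _] := is_derive_f x.
  exact/differentiable_continuous/derivable1_diffP.
- exact: is_derive_f.
- by move=> x; rewrite /f' mulrC divfK ?gt_eqF // /c; ring.
Qed.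

End stein_equation.

(** * Uniform random trees *)

Section uniform_trees.
Variables (R : realType) (d : measure_display) (T : measurableType d).
Variables (P : probability T R) (X : {RV P >-> tree}) (A : set tree).
Hypothesis uniX : uniform_on X A.

Let measurable_tree d' (S : measurableType d') (k : tree -> S) : measurable_fun setT k.
Proof. by move=> _ Y _. Qed.

Let measurable_X (B : set tree) : measurable (X @^-1` B).
Proof. by rewrite -[X @^-1` B]setTI; exact: (measurable_funP X). Qed.

(** There are countably many trees, and those outside [A] have mass zero. *)
Lemma negligible_outside : P (X @^-1` (~` A)) = 0%E.
Proof.
pose F (k : nat) := X @^-1` (~` A `&` [set t | choice.pickle t = k]).
have F0 k : P.-negligible (F k).
  apply/negligibleP; first exact: measurable_X.
  have [[t [At tk]]|no] := pselect (exists t, ~ A t /\ choice.pickle t = k); last first.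
    by rewrite /F (_ : _ `&` _ = set0) ?preimage_set0 ?measure0 // -subset0 => t [At tk]; apply: no; exists t.
  have -> : F k = X @^-1` [set t].
    apply/seteqP; split => w /=; first by move=> [_ wk]; apply: (pcan_inj choice.pickleK); rewrite wk tk.
    by rewrite /F /= => ->.
  by have := uniX t; rewrite indicE memNset // mul0r.
apply/negligibleP; first exact: measurable_X.
apply: negligibleS (negligible_bigcup F0) => w Aw.
by exists (choice.pickle (X w)).
Qed.

Lemma uniform_on_nonempty : exists t, A t.
Proof.
apply: contrapT => /forallNP noA; have := negligible_outside.
rewrite (_ : X @^-1` (~` A) = setT); last by apply/seteqP; split => // w _; exact: noA.
by rewrite probability_setT => /eqP; rewrite eqe oner_eq0.
Qed.

Hypothesis finA : finite_set A.

Lemma expectation_uniform (g : tree -> R) :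
  ('E_P[g \o X] = (tree_mean A g)%:E)%E.
Proof.
rewrite unlock.
pose S (w : T) := (\sum_(t <- fset_set A) (g t)%:E * (\1_(X @^-1` [set t]) w)%:E)%E.
have mI t : measurable_fun setT (fun w : T => (\1_(X @^-1` [set t]) w)%:E : \bar R).
  by apply/measurable_EFinP; apply: measurable_indic; exact: measurable_X.
transitivity (\int[P]_w S w)%E.
  apply: ae_eq_integral => //.
  - apply/measurable_EFinP.
    exact: (measurableT_comp (measurable_tree g) (measurable_funP X)).
  - by apply: emeasurable_sum => t; apply: emeasurable_funM.
  - exists (X @^-1` (~` A)); split; [exact: measurable_X|exact: negligible_outside|].
    move=> w /= nw Aw; apply: nw => _; rewrite /S.
    rewrite (bigD1_seq (X w)) ?fset_uniq //=; last by rewrite in_fset_set // inE.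
    rewrite indicE mem_set // mule1 big1 ?adde0 // => t tw.
    by rewrite indicE memNset ?mule0 //= => /eqP; rewrite eq_sym (negbTE tw).
rewrite integral_sum //; last first.
  move=> t; apply: integrableZl => //.
  by apply: integrable_indic => //; rewrite ?probability_setT ?ltry.
rewrite /tree_mean mulr_suml -sumEFin; apply: eq_big_seq => t tA.
rewrite integralZl //; last first.
  by apply: integrable_indic => //; rewrite ?probability_setT ?ltry.
have -> : (\int[P]_w (\1_(X @^-1` [set t]) w)%:E = (\1_A t / (#|` fset_set A|)%:R)%:E)%E.
  by rewrite integral_indic // setIT; exact: (uniX t).
by rewrite indicE; rewrite in_fset_set // in tA; rewrite tA mul1r -EFinM.
Qed.

Lemma variance_uniform (g : tree -> R) :
  ('V_P[g \o X] = (tree_mean A (fun t => (g t - tree_mean A g) ^+ 2))%:E)%E.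
Proof.
rewrite /variance covariance.unlock -expectation_uniform.
by congr expectation; apply/funext => w; rewrite /= expectation_uniform /= expr2.
Qed.

End uniform_trees.

Section tree_mean.
Variables (R : realType) (A : set tree).
Hypotheses (finA : finite_set A) (A_nonempty : exists t, A t).
Implicit Types g : tree -> R.

Lemma tree_meanE g : tree_mean A g = mean (fun x : fset_set A => g (val x)).
Proof. by rewrite /tree_mean /mean big_seq_fsetE cardfE. Qed.

Lemma fset_set_gt0 : (0 < #|{: fset_set A}|)%N.
Proof.
case: A_nonempty => t At; rewrite -cardfE cardfs_gt0; apply/fset0Pn; exists t.
by rewrite in_fset_set // inE.
Qed.

End tree_mean.

(** * The word of a uniform tree *)

Lemma tree_size_stat nn t : trees_of nn t -> tree_size t = stat_size nn.
Proof.
move=> tn; rewrite /stat_size (@fsbig_setT_seq _ _ _ _ (undup (code t))) ?undup_uniq //.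
  under eq_bigr do rewrite -tn -count_code.
  rewrite -size_code -(perm_size (perm_count_undup (code t))) size_flatten.
  rewrite /shape -map_comp sumnE big_map.
  by apply: eq_bigr => c _; rewrite /= size_nseq.
by move=> i; rewrite mem_undup -tn -count_code => /count_memPn.
Qed.

Lemma trees_of_words nn : (exists t, trees_of nn t) ->
  exists m (s : 'I_m.+1 -> nat),
    [/\ m.+1 = stat_size nn, (\sum_i s i + 1 = m.+1)%N, multiplicity s =1 nn &
        forall t, trees_of nn t <-> exists sigma, code t = word s sigma].
Proof.
move=> [t0 t0n]; have sz := tree_size_stat t0n.
have sz0 := code_gt0 t0; rewrite size_code in sz0.
exists (tree_size t0).-1; have szE := prednK sz0.
have szt : size (code t0) == (tree_size t0).-1.+1 by rewrite szE size_code.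
exists (tnth (Tuple szt)).
have wE sigma : word (tnth (Tuple szt)) sigma =
    [tuple tnth (Tuple szt) (sigma i) | i < (tree_size t0).-1.+1].
  by [].
split.
- by rewrite szE.
- rewrite -(big_tuple _ _ (Tuple szt) xpredT id) /= -sumnE.
  by rewrite sumn_code size_code szE.
- move=> c; rewrite /multiplicity.
  rewrite -(big_tuple _ _ (Tuple szt) xpredT (fun x => nat_of_bool (x == c))) /=.
  rewrite -t0n -count_code -sum1_count [RHS]big_mkcond /=.
  by apply: eq_bigr => x _; case: (x == c).
- move=> t; split.
    move=> tn; have /tuple_permP[sigma] : perm_eq (code t) (Tuple szt).
      apply/allP => c _ /=; rewrite !count_code; apply/eqP.
      by rewrite tn t0n.
    by move=> ->; exists sigma.
  move=> [sigma tE] c; rewrite -count_code -t0n -count_code.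
  have /seq.permP : perm_eq (code t) (Tuple szt); last exact.
  by rewrite tE wE; apply/tuple_permP; exists sigma.
Qed.

(** * Truncated functionals as sums over the windows of a random word *)

Section window.
Variables (n K : nat).
Local Notation N := n.+1.
Local Open Scope set_scope.
Local Open Scope ring_scope.
Implicit Types (i x : 'I_N).

Definition window i : {set 'I_N} := [set x : 'I_N | ((x - i)%R < K)%N].

Let count_small : (\sum_(x < N | (x < K)%N) 1 <= K)%N.
Proof.
rewrite big_mkcond -(big_mkord xpredT (fun x : nat => if (x < K)%N then 1%N else 0%N)).
elim: (N) => [|m]; first by rewrite big_nil.
rewrite big_nat_recr //= => IH; case: ltnP => mK; last by rewrite addn0.
apply: leq_trans mK; rewrite addn1 ltnS.
apply: (@leq_trans (\sum_(0 <= x < m) 1)); first by apply: leq_sum => x _; case: ifP.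
by rewrite sum_nat_const_nat subn0 muln1.
Qed.

Lemma card_window i : (#|window i| <= K)%N.
Proof.
rewrite -sum1_card (reindex_inj (addIr i)) /=; apply: leq_trans count_small.
by rewrite leq_eqVlt; apply/orP; left; apply/eqP/eq_bigl => x; rewrite inE addrK.
Qed.

Lemma window_covering x : (\sum_(i | x \in window i) 1 <= K)%N.
Proof.
rewrite (reindex_inj (subrI x)) /=; apply: leq_trans count_small.
by rewrite leq_eqVlt; apply/orP; left; apply/eqP/eq_bigl => i; rewrite inE subKr.
Qed.

End window.

Section windows.
Variables (R : realType) (n : nat) (s : 'I_n.+1 -> nat) (f : tree -> R) (K : nat).
Local Notation N := n.+1.
Local Notation window := (@window n K).
Local Open Scope set_scope.
Local Open Scope ring_scope.
Implicit Types (sigma : 'S_N) (i x : 'I_N) (w : seq nat).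

Definition window_value i sigma : R :=
  \sum_(t <- small_trees K) f t * (prefix (code t) (rot i (word s sigma)))%:R.

Definition value_bound : R := \sum_(t <- small_trees K) `|f t|.

Definition occurrence_sum w : R :=
  \sum_(t <- small_trees K) f t * (occurrences t w)%:R.

Hypothesis KN : (K <= N)%N.

(** Words of trees of size at most [K] are recognized inside a window. *)
Lemma depends_on_window i : depends_on (window i) (window_value i).
Proof.
move=> sigma tau e; rewrite /window_value.
rewrite [LHS]big_seq [RHS]big_seq; apply: eq_bigr => t.
rewrite mem_small_trees => tK; congr (f t * (nat_of_bool _)%:R).
have tN : (size (code t) <= N)%N by rewrite size_code (leq_trans tK).
rewrite !rot_word -[word s (rotation i * sigma)]rot0 -[word s (rotation i * tau)]rot0.
rewrite !prefix_word // rot0; congr (_ == _).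
apply/eq_in_map => y yt; rewrite !permM permE; congr (s _); apply: e.
rewrite inE addrAC subrr add0r.
have -> : nat_of_ord y = index y (take (size (code t)) (enum 'I_N)).
  rewrite -[LHS](index_enum_ord y).
  by rewrite -{1}(cat_take_drop (size (code t)) (enum 'I_N)) index_cat yt.
apply: leq_trans tK; rewrite -size_code.
by move: yt; rewrite -index_mem size_takel // size_enum_ord.
Qed.

Lemma window_value_le i sigma : `|window_value i sigma| <= value_bound.
Proof.
rewrite (le_trans (ler_norm_sum _ _ _)) // ler_sum // => t _.
by rewrite normrM ler_piMr // ger0_norm // lern1 leq_b1.
Qed.

Lemma total_window_value sigma : total window_value sigma = occurrence_sum (word s sigma).
Proof.
rewrite /total exchange_big /=; apply: eq_bigr => t _.
by rewrite -mulr_sumr /occurrences size_word natr_sum.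
Qed.

Lemma occurrence_sum_rot (k : 'I_N) sigma :
  occurrence_sum (rot k (word s sigma)) = occurrence_sum (word s sigma).
Proof.
rewrite -[in RHS](rotK k (word s sigma)); apply: eq_bigr => t _; congr (_ * _%:R).
rewrite rotK /occurrences size_rot size_word [RHS](reindex_inj (addrI k)) /=.
apply: eq_bigr => i _; congr (nat_of_bool (prefix _ _)).
rewrite (rot_word s (k + i)) !rot_word; congr word; apply/permP => x.
by rewrite !permM !permE addrA.
Qed.

End windows.

Section normalized.
Variables (R : realType) (A : set tree) (N : nat).

Definition normalized (g : tree -> R) (t : tree) : R :=
  (g t - tree_mean A g) / Num.sqrt N%:R.

Definition normalized_var (g : tree -> R) : R :=
  tree_mean A (fun t => normalized g t ^+ 2).

End normalized.

Section truncated_functional.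
Variables (R : realType) (nn : nat -> nat) (f : tree -> R) (K : nat).
Hypothesis nn_tree : exists t, trees_of nn t.
Local Notation A := (trees_of nn).
Local Notation N := (stat_size nn).
Local Notation F := (additive_functional (truncate K f)).
Local Notation Y := (normalized A N F).

Lemma finite_trees_of : finite_set A.
Proof. by have [m [s [_ _ _ /finite_codeA]]] := trees_of_words nn_tree. Qed.

Let mean_truncated m (s : 'I_m.+1 -> nat) (Phi : R -> R) :
    (\sum_i s i + 1 = m.+1)%N ->
    (forall t, A t <-> exists sigma, code t = word s sigma) ->
  mean (fun sigma => Phi (total (window_value s f K) sigma)) =
  tree_mean A (fun t => Phi (F t)).
Proof.
move=> ss codeA; transitivity (tree_mean A (fun t => Phi (occurrence_sum f K (code t)))).
  rewrite -(@mean_word R _ s ss A codeA (fun w => Phi (occurrence_sum f K w))).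
    by apply: eq_mean => sigma; rewrite total_window_value.
  by move=> k sigma; rewrite occurrence_sum_rot.
congr (_ / _); apply: eq_bigr => t _; congr Phi.
rewrite additive_truncateE; apply: eq_bigr => u _.
by rewrite occurrences_code.
Qed.

Let mean_normalized m (s : 'I_m.+1 -> nat) (Phi : R -> R) :
    m.+1 = N -> (\sum_i s i + 1 = m.+1)%N ->
    (forall t, A t <-> exists sigma, code t = word s sigma) ->
  mean (fun sigma => Phi (fluctuation (window_value s f K) sigma)) =
  tree_mean A (fun t => Phi (Y t)).
Proof.
move=> mN ss codeA; rewrite /normalized -(mean_truncated id ss codeA) -mN.
exact: (mean_truncated (fun x => Phi ((x - mean (total (window_value s f K))) / Num.sqrt m.+1%:R)) ss codeA).
Qed.

(** Both sides are invariant under rotation of the word, which allows to pass from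
    trees to shuffled words. *)
Lemma stein_identity_trees (g g' : R -> R) (M C eps : R) : (K <= N)%N ->
    (forall x, `|g x| <= M) -> (forall x, `|g' x| <= M) -> 0 <= eps -> 0 <= C ->
    (forall x y, `|g x - g y - g' x * (x - y)| <=
                 (eps * (1 + x ^+ 2) + C * (x - y) ^+ 2) * `|x - y|) ->
    (forall x y, `|g' x - g' y| <= eps * (1 + x ^+ 2) + C * (x - y) ^+ 2) ->
  `|tree_mean A (fun t => Y t * g (Y t)) - normalized_var A N F * tree_mean A (fun t => g' (Y t))|
  <= stein_constant K (value_bound f K) * (1 + normalized_var A N F) *
     (eps + (M + C) / Num.sqrt N%:R).
Proof.
move=> KN gM g'M eps0 C0 gt g'm.
have [m [s [mN ss _ codeA]]] := trees_of_words nn_tree.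
rewrite -mN in KN.
have := stein_identity_error (@card_window m K) (@window_covering m K)
  (@depends_on_window R m s f K KN) (@window_value_le R m s f K) gM g'M eps0 C0 gt g'm.
rewrite (mean_normalized (fun x => x * g x) mN ss codeA).
rewrite /fluctuation_var (mean_normalized (fun x => x ^+ 2) mN ss codeA).
by rewrite (mean_normalized g' mN ss codeA) mN.
Qed.

Lemma normalized_varE : (K + K <= N)%N ->
  normalized_var A N F = \sum_(t <- small_trees K) \sum_(t' <- small_trees K)
    f t * f t' *
   (draw R nn N [::] (code t) * (count_mem t' (fringe t))%:R +
    draw R nn N [::] (code t') * ((count_mem t (fringe t'))%:R - (t == t')%:R) +
    (N%:R + 1 - (tree_size t)%:R - (tree_size t')%:R) *
      draw R nn N [::] (code t ++ code t') -
    N%:R * (draw R nn N [::] (code t) * draw R nn N [::] (code t'))).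
Proof.
move=> KN; have [m [s [mN ss /funext sn codeA]]] := trees_of_words nn_tree.
rewrite /normalized_var -(mean_normalized (fun x => x ^+ 2) mN ss codeA).
rewrite -mN -sn in KN *; set W := total (window_value s f K).
have N0 : m.+1%:R != 0 :> R by rewrite pnatr_eq0.
have -> : mean (fun sigma => fluctuation (window_value s f K) sigma ^+ 2) =
    (mean (fun sigma => W sigma * W sigma) - mean W * mean W) / m.+1%:R.
  rewrite /fluctuation -/W; under eq_mean => sigma do
    rewrite expr_div_n sqr_sqrtr ?ler0n //.
  rewrite meanZr; congr (_ / _).
  rewrite (_ : mean _ = mean (fun sigma => W sigma * W sigma - (2 * mean W) * W sigma + mean W ^+ 2)).
    rewrite meanD meanB meanZ (mean_cst (perms_gt0 m)); ring.
  by apply: eq_mean => sigma; ring.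
have WE sigma : W sigma = \sum_(t <- small_trees K) f t * (occurrences t (word s sigma))%:R.
  exact: total_window_value.
rewrite (eq_mean (Z2 := fun sigma => \sum_(t <- small_trees K) \sum_(t' <- small_trees K)
    f t * f t' * ((occurrences t (word s sigma))%:R * (occurrences t' (word s sigma))%:R))); last first.
  move=> sigma; rewrite WE mulr_suml; apply: eq_bigr => t _; rewrite mulr_sumr.
  by apply: eq_bigr => t' _; ring.
have small t : t \in small_trees K -> (tree_size t <= m.+1)%N.
  by rewrite mem_small_trees; lia.
have -> : mean W = \sum_(t <- small_trees K) f t * (m.+1%:R * draw R (multiplicity s) m.+1 [::] (code t)).
  rewrite (eq_mean WE) mean_sum big_seq [RHS]big_seq; apply: eq_bigr => t tK.
  by rewrite meanZ mean_occurrences // small.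
rewrite mean_sum mulr_suml -sumrB mulr_suml.
rewrite [LHS]big_seq [RHS]big_seq; apply: eq_bigr => t tK.
rewrite mean_sum mulr_sumr -sumrB mulr_suml.
rewrite [LHS]big_seq [RHS]big_seq; apply: eq_bigr => t' t'K.
rewrite meanZ mean_occurrences_mul; first by field.
by move: tK t'K; rewrite !mem_small_trees; lia.
Qed.

End truncated_functional.

(** * Moduli of continuity of bounded functions *)

Section moduli.
Variable R : realType.
Implicit Types (g : R -> R) (x y : R).

Lemma uniformly_continuous_segment g a eps : continuous g -> 0 < eps ->
  exists2 delta, 0 < delta &
    forall x y, `|x| <= a -> `|x - y| < delta -> `|g x - g y| <= eps.
Proof.
move=> cg eps0.
have /compact_near_coveringP cov := @segment_compact R (- a) a.
have := cov R (0^'+) (fun delta x => forall y, `|x - y| < delta -> `|g x - g y| <= eps) _.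
case; last first.
  move=> r /= r0 H; exists (r / 2); first by rewrite divr_gt0.
  move=> x y xa xy; apply: (H (r / 2)) => //=.
  - by rewrite sub0r normrN gtr0_norm ?divr_gt0 // ltr_pdivrMr // ltr_pMr // ltr1n.
  - by rewrite divr_gt0.
  - by rewrite in_itv /= -ler_norml.
move=> x _; have /cvgrPdist_lt/(_ (eps / 2)) := cg x.
rewrite divr_gt0 // => /(_ isT)/nbhs_ballP[r /= r0 rg].
exists (ball x (r / 2), [set delta | delta < r / 2]).
  split => /=; first by apply: nbhsx_ballx; rewrite divr_gt0.
  by apply: nbhs_right_lt; rewrite divr_gt0.
move=> [x' delta] /= [xx' dr] y x'y.
have gx' : `|g x - g x'| < eps / 2.
  by apply: rg; apply: le_ball xx'; rewrite ler_pdivrMr // ler_pMr // ler1n.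
have gy : `|g x - g y| < eps / 2.
  apply: rg; rewrite /ball /= (le_lt_trans (ler_distD x' _ _)) //.
  by rewrite [r]splitr ltrD // (lt_trans x'y).
by rewrite (le_trans (ler_distD (g x) _ _)) // [eps]splitr lerD // ltW // distrC.
Qed.

(** The quadratic terms absorb the lack of uniform continuity at infinity; their
    mean is a variance in the applications. *)
Lemma bounded_modulus g M eps : continuous g -> (forall x, `|g x| <= M) -> 0 < eps ->
  exists2 C, 0 <= C &
    forall x y, `|g x - g y| <= eps * (1 + x ^+ 2) + C * (x - y) ^+ 2.
Proof.
move=> cg gM eps0; have M0 : 0 <= M := le_trans (normr_ge0 _) (gM 0).
(* beyond [a] the trivial bound [2 * M] is at most [eps * x ^+ 2] *)
pose a := 1 + 2 * M / eps.
have a1 : 1 <= a by rewrite lerDl divr_ge0 ?mulr_ge0 // ltW.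
have [delta d0 gd] := @uniformly_continuous_segment g a eps cg eps0.
have g2M x y : `|g x - g y| <= 2 * M.
  by rewrite (le_trans (ler_normB _ _)) // mulr_natl mulr2n lerD.
have q0 : 0 <= 2 * M / delta ^+ 2.
  by apply: divr_ge0; [exact: mulr_ge0|exact: sqr_ge0].
exists (2 * M / delta ^+ 2) => // x y.
have C0 : 0 <= 2 * M / delta ^+ 2 * (x - y) ^+ 2 by rewrite mulr_ge0 ?sqr_ge0.
have e0 : 0 <= eps * x ^+ 2 by rewrite mulr_ge0 ?sqr_ge0 // ltW.
have [xa|xa] := lerP `|x| a; last first.
  have : 2 * M <= eps * x ^+ 2.
    rewrite -ler_pdivrMl // mulrC -real_normK ?num_real // expr2.
    apply: (@le_trans _ _ a); first by rewrite lerDr.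
    by rewrite -[leLHS]mulr1 ler_pM // ?(ltW xa) ?(le_trans ler01) // (le_trans a1) // ltW.
  by have := g2M x y; lra.
have [xy|xy] := ltrP `|x - y| delta.
  by have := gd x y xa xy; lra.
have : 2 * M <= 2 * M / delta ^+ 2 * (x - y) ^+ 2.
  rewrite mulrAC ler_pdivlMr ?exprn_gt0 // ler_wpM2l ?mulr_ge0 //.
  by rewrite -[leRHS]real_normK ?num_real // ler_pXn2r ?nnegrE // ltW.
by have := g2M x y; lra.
Qed.

Lemma taylor_modulus (g g' : R -> R) (eps C : R) :
    (forall x : R, is_derive x 1 g (g' x)) -> 0 <= C ->
    (forall x y, `|g' x - g' y| <= eps * (1 + x ^+ 2) + C * (x - y) ^+ 2) ->
  forall x y, `|g x - g y - g' x * (x - y)| <=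
    (eps * (1 + x ^+ 2) + C * (x - y) ^+ 2) * `|x - y|.
Proof.
move=> dg C0 mg x y.
have cg : continuous g.
  move=> z; have [dz _] := dg z.
  exact/differentiable_continuous/derivable1_diffP.
have [z xz ->] : exists2 z, `|x - z| <= `|x - y| & g x - g y = g' z * (x - y).
  have [xy|yx] := lerP x y.
    have [z] := @MVT_segment R g g' x y xy (fun z _ => dg z) (continuous_subspaceT cg).
    rewrite in_itv /= => /andP[xz zy] e; exists z.
      by rewrite !ler0_norm ?subr_le0 // !opprB lerB.
    by rewrite -[LHS]opprB e -mulrN opprB.
  have [z] := @MVT_segment R g g' y x (ltW yx) (fun z _ => dg z) (continuous_subspaceT cg).
  rewrite in_itv /= => /andP[yz zx] e; exists z => //.
  by rewrite !ger0_norm ?subr_ge0 ?(ltW yx) // lerB.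
rewrite -mulrBl normrM ler_wpM2r // distrC (le_trans (mg x z)) // lerD2l ler_wpM2l //.
by rewrite -[leLHS]real_normK ?num_real // -[leRHS]real_normK ?num_real // ler_pXn2r ?nnegrE.
Qed.

End moduli.

(** * The central limit theorem *)

Section comparison.
Variables (R : realType) (A : set tree) (N : nat).
Hypotheses (finA : finite_set A) (A0 : exists t, A t).
Implicit Types g h : tree -> R.

Lemma normalizedD g h t :
  normalized A N (fun u => g u + h u) t = normalized A N g t + normalized A N h t.
Proof. by rewrite /normalized !tree_meanE meanD; ring. Qed.

(** Replacing [g + h] by [g] costs little when [h] has small variance. *)
Lemma normalized_comparison (phi : R -> R) (eps C : R) g h :
    (forall x y, `|phi x - phi y| <= eps * (1 + x ^+ 2) + C * (x - y) ^+ 2) ->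
  `|tree_mean A (fun t => phi (normalized A N g t)) -
    tree_mean A (fun t => phi (normalized A N (fun u => g u + h u) t))| <=
  eps * (1 + normalized_var A N g) + C * normalized_var A N h.
Proof.
move=> mphi; rewrite /normalized_var !tree_meanE -meanB.
apply: (le_trans (mean_norm _)).
rewrite -[X in X + mean _](@mean_cst R _ (fset_set_gt0 finA A0)) -meanD -meanZ -meanZ -meanD.
apply: mean_le => x /=; rewrite normalizedD (le_trans (mphi _ _)) //.
by rewrite opprD addrA subrr sub0r sqrrN.
Qed.

Lemma normalized_var_ge0 g : 0 <= normalized_var A N g.
Proof. by rewrite /normalized_var tree_meanE mean_ge0 // => x; rewrite sqr_ge0. Qed.

Lemma normalized_varD_le g h :
  normalized_var A N (fun u => g u + h u) <=
  2 * (normalized_var A N g + normalized_var A N h).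
Proof.
rewrite /normalized_var !tree_meanE -meanD -meanZ; apply: mean_le => x.
rewrite normalizedD; set a := normalized _ _ _ _; set b := normalized _ _ _ _.
have := sqr_ge0 (a - b); nra.
Qed.

Lemma tree_mean_norm_le (k : R -> R) (M : R) (Z : tree -> R) :
  (forall x, `|k x| <= M) -> `|tree_mean A (fun t => k (Z t))| <= M.
Proof.
move=> kM; rewrite tree_meanE (le_trans (mean_norm _)) //.
rewrite -[leRHS](@mean_cst R _ (fset_set_gt0 finA A0)).
by apply: mean_le => x; exact: kM.
Qed.

End comparison.

Section central_limit.
Variables (R : realType) (n : nat -> nat -> nat) (p : nat -> R).
Variables (f : tree -> R) (gamma : R).
Hypothesis nonempty : forall k, exists t, trees_of (n k) t.
Hypothesis hsize : stat_size (n k) @[k --> \oo] --> \oo.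
Hypothesis p_ge0 : forall i, 0 <= p i.
Hypothesis hnp : forall i, (n k i)%:R / (stat_size (n k))%:R @[k --> \oo] --> p i.
Hypothesis gamma_ge0 : 0 <= gamma.
Hypothesis hi : gamma_variance p (truncate K f) @[K --> \oo] --> gamma.

Local Notation A k := (trees_of (n k)).
Local Notation N k := (stat_size (n k)).
Local Notation Fin K := (additive_functional (truncate K f)).
Local Notation Fout K := (additive_functional (truncate_compl K f)).
Local Notation F := (additive_functional f).

Hypothesis hii : forall eta, 0 < eta ->
  \forall K \near \oo, \forall k \near \oo, normalized_var (A k) (N k) (Fout K) < eta.

Let finA k : finite_set (A k). Proof. exact: finite_trees_of. Qed.

Let N_gt0 k : (0 < N k)%N.
Proof.
have [t tn] := nonempty k.
by rewrite -(tree_size_stat tn) -size_code code_gt0.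
Qed.

Let FE K : F = (fun t => Fin K t + Fout K t).
Proof.
apply/funext => t; rewrite /additive_functional -big_split /=.
by apply: eq_bigr => u _; rewrite /truncate_compl addrC subrK.
Qed.

Let large_size j : \forall k \near \oo, (j <= N k)%N.
Proof. by move/cvgnyPge : hsize; exact. Qed.

Lemma cvg_normalized_var K :
  normalized_var (A k) (N k) (Fin K) @[k --> \oo] --> gamma_variance p (truncate K f).
Proof.
rewrite gamma_varianceE // /limit_variance.
apply: (@cvg_trans _ ((\sum_(t <- small_trees K) \sum_(t' <- small_trees K)
    f t * f t' *
   (draw R (n k) (N k) [::] (code t) * (count_mem t' (fringe t))%:R +
    draw R (n k) (N k) [::] (code t') * ((count_mem t (fringe t'))%:R - (t == t')%:R) +
    ((N k)%:R + 1 - (tree_size t)%:R - (tree_size t')%:R) *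
      draw R (n k) (N k) [::] (code t ++ code t') -
    (N k)%:R * (draw R (n k) (N k) [::] (code t) * draw R (n k) (N k) [::] (code t'))))
   @[k --> \oo])).
  apply: near_eq_cvg; near=> k; rewrite normalized_varE //.
  by near: k; exact: large_size.
apply: cvg_big => [|t _]; first exact: add_continuous.
apply: cvg_big => [|t' _]; first exact: add_continuous.
by apply: cvgMr; exact: limit_covariance_cvg.
Unshelve. all: by end_near. Qed.

Let small_sqrt (c eps : R) : 0 < eps ->
  \forall k \near \oo, c / Num.sqrt (N k)%:R <= eps.
Proof.
move=> eps0; have /cvgryPge/(_ ((c / eps) ^+ 2)) := @cvg_size R _ hsize.
apply: filterS => k ck.
have r0 : 0 < Num.sqrt (N k)%:R :> R by rewrite sqrtr_gt0 ltr0n.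
rewrite ler_pdivrMr // mulrC -ler_pdivrMr // (le_trans (ler_norm _)) //.
by rewrite -sqrtr_sqr ler_wsqrtr.
Qed.

Variables (phi : R -> R) (M : R).
Hypotheses (cphi : continuous phi) (phiM : forall x, `|phi x| <= M).

(** The variance of the normalized functional tends to zero. *)
Lemma tree_clt_degenerate : gamma = 0 ->
  tree_mean (A k) (fun t => phi (normalized (A k) (N k) F t)) @[k --> \oo] --> phi 0.
Proof.
move=> g0; apply/cvgrPdist_lt => e e0.
have e4 : 0 < e / 4 by rewrite divr_gt0.
have [C C0 mphi] := bounded_modulus cphi phiM e4.
pose eta := e / (16 * (C + 1)).
have eta0 : 0 < eta by rewrite divr_gt0 // mulr_gt0 // ltr_wpDl.
have etaE : eta * (16 * (C + 1)) = e by rewrite divfK // gt_eqF // mulr_gt0 // ltr_wpDl.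
have [K [KV Kg]] : exists K,
    (\forall k \near \oo, normalized_var (A k) (N k) (Fout K) < eta) /\
    `|gamma - gamma_variance p (truncate K f)| < eta.
  apply: (@filter_ex _ \oo); near=> K; split; near: K; first exact: hii.
  by move/cvgrPdist_lt : hi; exact.
have /cvgrPdist_lt/(_ _ eta0) Kv := @cvg_normalized_var K.
near=> k.
have V1 : normalized_var (A k) (N k) (Fout K) < eta by near: k.
have V2 : `|gamma_variance p (truncate K f) - normalized_var (A k) (N k) (Fin K)| < eta.
  by near: k.
have V3 : normalized_var (A k) (N k) (Fin K) < 2 * eta.
  by move: Kg V2; rewrite g0 !ltr_norml => /andP[? ?] /andP[? ?]; lra.
have V4 := normalized_varD_le (A k) (N k) (Fin K) (Fout K).
rewrite -FE in V4.
have H : `|phi 0 - tree_mean (A k) (fun t => phi (normalized (A k) (N k) F t))| <=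
    e / 4 + C * normalized_var (A k) (N k) F.
  rewrite /normalized_var !tree_meanE.
  rewrite -[phi 0](@mean_cst R _ (fset_set_gt0 (finA k) (nonempty k))) -meanB.
  rewrite (le_trans (mean_norm _)) //.
  rewrite -[e / 4](@mean_cst R _ (fset_set_gt0 (finA k) (nonempty k))) -meanZ -meanD.
  apply: mean_le => x; apply: (le_trans (mphi _ _)).
  by rewrite expr0n addr0 mulr1 sub0r sqrrN.
apply: (le_lt_trans H).
have : C * normalized_var (A k) (N k) F <= C * (6 * eta).
  by rewrite ler_wpM2l //; lra.
by have : 0 <= C * eta by [rewrite mulr_ge0 // ltW]; nra.
Unshelve. all: by end_near. Qed.

(** The truncation level [K] is fixed before the trees grow, and Stein's equation is
    that of the limiting variance [gamma]: the variance for [K] only enters through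
    its distance to [gamma]. *)
Lemma tree_clt_normal : 0 < gamma ->
  tree_mean (A k) (fun t => phi (normalized (A k) (N k) F t)) @[k --> \oo] -->
  normal_mean (Num.sqrt gamma) phi.
Proof.
move=> g0; apply/cvgrPdist_lt => e e0; set c := normal_mean _ _.
have s0 : Num.sqrt gamma != 0 by rewrite gt_eqF // sqrtr_gt0.
have [g [g' [Mg [gM g'M cg' dg stein]]]] := stein_equation s0 cphi phiM.
rewrite sqr_sqrtr // -/c in stein.
have Mg0 : 0 <= Mg := le_trans (normr_ge0 _) (gM 0).
pose eps1 := e / (8 * (2 + gamma)).
have g2 : 0 < 2 + gamma by rewrite ltr_wpDr.
have eps10 : 0 < eps1 by rewrite divr_gt0 // mulr_gt0.
have eps1E : eps1 * (2 + gamma) = e / 8 by rewrite /eps1; field; rewrite gt_eqF.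
have [C1 C10 mphi] := bounded_modulus cphi phiM eps10.
pose eta := e / (8 * (C1 + 1)).
have C11 : 0 < C1 + 1 by rewrite ltr_wpDl.
have eta0 : 0 < eta by rewrite divr_gt0 // mulr_gt0.
have etaE : C1 * eta <= e / 8.
  have -> : e / 8 = (C1 + 1) * eta by rewrite /eta; field; rewrite gt_eqF.
  by rewrite ler_wpM2r ?ltW // ltrDl.
pose e1 := Num.min (1 / 2) (e / (16 * (Mg + 1))).
have Mg1 : 0 < Mg + 1 by rewrite ltr_wpDl.
have e10 : 0 < e1 by rewrite lt_min !divr_gt0 // mulr_gt0.
have [K [KV Kg]] : exists K,
    (\forall k \near \oo, normalized_var (A k) (N k) (Fout K) < eta) /\
    `|gamma - gamma_variance p (truncate K f)| < e1.
  apply: (@filter_ex _ \oo); near=> K; split; near: K; first exact: hii.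
  by move/cvgrPdist_lt : hi; exact.
pose S := `|stein_constant K (value_bound f K)|.
have S1 : 0 < S + 1 by rewrite ltr_wpDl // /S normr_ge0.
pose eps2 := e / (8 * ((S + 1) * (2 + gamma))).
have eps20 : 0 < eps2 by rewrite divr_gt0 // !mulr_gt0.
have eps2E : (S + 1) * (2 + gamma) * eps2 = e / 8.
  by rewrite /eps2; field; rewrite !gt_eqF.
have [C2 C20 mg'] := bounded_modulus cg' g'M eps20.
have tg := taylor_modulus dg C20 mg'.
have /cvgrPdist_lt/(_ _ e10) Kv := @cvg_normalized_var K.
near=> k.
have KN : (K <= N k)%N by near: k; exact: large_size.
have V1 : normalized_var (A k) (N k) (Fout K) < eta by near: k.
have V2 : `|gamma_variance p (truncate K f) - normalized_var (A k) (N k) (Fin K)| < e1.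
  by near: k.
have V3 : (Mg + C2) / Num.sqrt (N k)%:R <= eps2 by near: k; exact: small_sqrt.
have St := stein_identity_trees f (nonempty k) KN gM g'M (ltW eps20) C20 tg mg'.
have Cm := normalized_comparison (N k) (finA k) (nonempty k) (Fin K) (Fout K) mphi.
have v0 := normalized_var_ge0 (A k) (N k) (Fin K).
have w0 := normalized_var_ge0 (A k) (N k) (Fout K).
have Mg' := tree_mean_norm_le (finA k) (nonempty k) (normalized (A k) (N k) (Fin K)) g'M.
rewrite -FE in Cm.
have SE : tree_mean (A k) (fun t => phi (normalized (A k) (N k) (Fin K) t)) - c =
    gamma * tree_mean (A k) (fun t => g' (normalized (A k) (N k) (Fin K) t)) -
    tree_mean (A k) (fun t => normalized (A k) (N k) (Fin K) t *
                               g (normalized (A k) (N k) (Fin K) t)).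
  rewrite !tree_meanE -[c](@mean_cst R _ (fset_set_gt0 (finA k) (nonempty k))).
  by rewrite -meanZ -!meanB; apply: eq_mean => x; rewrite stein.
move: St Cm Mg' SE v0 w0 V1 V2.
set v := normalized_var _ _ _; set w := normalized_var _ _ _.
set a := tree_mean _ _; set b := tree_mean _ _; set a1 := tree_mean _ _; set a2 := tree_mean _ _.
move=> St Cm Mg' SE v0 w0 V1 V2.
have e1h : e1 <= 1 / 2 by rewrite ge_min lexx.
have e1M : e1 <= e / (16 * (Mg + 1)) by rewrite ge_min lexx orbT.
have gv : `|gamma - v| <= 2 * e1.
  rewrite (le_trans (ler_distD (gamma_variance p (truncate K f)) _ _)) //.
  by rewrite mulr_natl mulr2n lerD // ltW.
have v1 : 1 + v <= 2 + gamma by move: gv; rewrite ler_norml => /andP[? ?]; lra.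
have T1 : `|a1 - a2| <= e / 8 + e / 8.
  apply: (le_trans Cm); apply: lerD.
    by rewrite -eps1E ler_wpM2l // ltW.
  by apply: le_trans etaE; rewrite ler_wpM2l // ltW.
have T2 : `|(gamma - v) * b| <= e / 8.
  rewrite normrM; apply: (@le_trans _ _ (2 * (e / (16 * (Mg + 1))) * (Mg + 1))).
    apply: ler_pM => //; last by rewrite (le_trans Mg') // lerDl.
    by rewrite (le_trans gv) // ler_wpM2l.
  by rewrite le_eqVlt; apply/orP; left; apply/eqP; field; rewrite gt_eqF.
have T3 : `|a - v * b| <= e / 8 + e / 8.
  apply: (le_trans St).
  apply: (@le_trans _ _ ((S + 1) * (2 + gamma) * (eps2 + eps2))); last by rewrite mulrDr eps2E.
  have q0 : 0 <= eps2 + (Mg + C2) / Num.sqrt (N k)%:R.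
    by rewrite addr_ge0 ?(ltW eps20) // divr_ge0 ?sqrtr_ge0 ?addr_ge0.
  apply: (@le_trans _ _ (S * (1 + v) * (eps2 + (Mg + C2) / Num.sqrt (N k)%:R))).
    by rewrite ler_wpM2r // ler_wpM2r ?addr_ge0 // ler_norm.
  apply: ler_pM => //; first by rewrite mulr_ge0 ?addr_ge0 // normr_ge0.
    by apply: ler_pM; rewrite ?addr_ge0 ?normr_ge0 // lerDl.
  by rewrite lerD2l.
have -> : c - a2 = (a1 - a2) - ((gamma - v) * b - (a - v * b)).
  by have -> : c = a1 - (gamma * b - a) by [rewrite -SE; ring]; ring.
rewrite (le_lt_trans (ler_normB _ _)) //.
apply: (@le_lt_trans _ _ (e / 8 + e / 8 + (e / 8 + (e / 8 + e / 8)))).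
  by rewrite lerD // (le_trans (ler_normB _ _)) // lerD.
by lra.
Unshelve. all: by end_near. Qed.

End central_limit.

Theorem theorem8p3 (R : realType) (n : nat -> nat -> nat) (p : nat -> R)
    (d : nat -> measure_display) (Omega : forall k, measurableType (d k))
    (P : forall k, probability (Omega k) R)
    (X : forall k, {RV (P k) >-> tree})
    (f : tree -> R) (gamma : R)
    (hn : forall k, degree_statistic (n k))
    (hsize : stat_size (n k) @[k --> \oo] --> \oo)
    (hp : prob_distribution p)
    (hnp : forall i, (n k i)%:R / (stat_size (n k))%:R @[k --> \oo] --> p i)
    (hX : forall k, uniform_on (X k) (trees_of (n k)))
    (hgamma : 0 <= gamma)
    (hi : gamma_variance p (truncate K f) @[K --> \oo] --> gamma)
    (hii : limn_esup (fun k =>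
             ('V_(P k)[additive_functional (truncate_compl K f) \o X k]
              * ((stat_size (n k))%:R^-1)%:E)%E) @[K --> \oo] --> 0%E) :
  cvg_in_distribution P
    (fun k w =>
       (additive_functional f (X k w)
        - fine ('E_(P k)[additive_functional f \o X k])%E)
       / Num.sqrt (stat_size (n k))%:R)
    (centered_normal gamma).
Proof.
have nonempty k : exists t, trees_of (n k) t := uniform_on_nonempty (hX k).
have finA k : finite_set (trees_of (n k)) := finite_trees_of (nonempty k).
have p_ge0 : forall i, 0 <= p i by case: hp.
have hout eta : 0 < eta -> \forall K \near \oo, \forall k \near \oo,
    normalized_var (trees_of (n k)) (stat_size (n k))
      (additive_functional (truncate_compl K f)) < eta.
  move=> eta0; have small : \forall K \near \oo, (limn_esup (fun k =>
      'V_(P k)[additive_functional (truncate_compl K f) \o X k]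
        * ((stat_size (n k))%:R^-1)%:E) < eta%:E)%E.
    exact: hii _ (nbhs_open_ereal_lt (f := fun=> eta) eta0).
  apply: filterS small => K /= /ereal_inf_lt[_ [V nV <-]] supV.
  apply: filterS nV => k Vk; rewrite -lte_fin.
  apply: le_lt_trans supV; apply: ereal_sup_ubound; exists k => //.
  rewrite (variance_uniform (hX k) (finA k)) -EFinM; congr (_%:E).
  rewrite /normalized_var /normalized !tree_meanE -meanZr; apply: eq_mean => x.
  by rewrite expr_div_n sqr_sqrtr ?ler0n.
move=> phi cphi [M phiM].
have limE : (\int[centered_normal gamma]_x (phi x)%:E =
    (if gamma == 0 then phi 0 else normal_mean (Num.sqrt gamma) phi)%:E)%E.
  rewrite /centered_normal; case: eqP => [_|/eqP g0].
    rewrite integral_dirac //; first by rewrite diracE mem_set // mul1e.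
    by apply/measurable_EFinP; exact: continuous_measurable_fun.
  apply: (integral_normal_mean _ cphi phiM).
rewrite limE.
have meanE k : ('E_(P k)[phi \o (fun w : Omega k =>
       (additive_functional f (X k w)
        - fine ('E_(P k)[additive_functional f \o X k])%E)
       / Num.sqrt (stat_size (n k))%:R)%R] =
   (tree_mean (trees_of (n k)) (fun t => phi (normalized (trees_of (n k))
      (stat_size (n k)) (additive_functional f) t)))%:E)%E.
  by rewrite -(expectation_uniform (hX k) (finA k)) (expectation_uniform (hX k) (finA k)).
under eq_fun do rewrite meanE.
apply: cvg_EFin; first by apply: nearW.
have [g0|g0] := eqVneq gamma 0.
  exact: (tree_clt_degenerate nonempty hsize p_ge0 hnp hi hout cphi phiM g0).
apply: (tree_clt_normal nonempty hsize p_ge0 hnp hgamma hi hout cphi phiM).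
by rewrite lt_neqAle eq_sym g0.
Qed.
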